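(* Let $n\ge1$ be an integer, fix $s\in(0,1)$ and assume that $u\in H^{2s_0}(\mathbb{R}^n)$ for some $s_0>s$. Then $$\lim_{t\to s}\Bigl\|\frac{(-\Delta)^t-(-\Delta)^s}{t-s}\,u-(-\Delta)^{s+\mathrm{Log}}_{\mathrm{spec}}u\Bigr\|_{L^2(\mathbb{R}^n)}=0.$$
   Context: Let $-\Delta=\int_{[0,\infty)}\lambda\,dE(\lambda)$ be the spectral resolution of the nonnegative self-adjoint Laplacian on $L^2(\mathbb{R}^n)$, and $E_{u,v}(B)=\langle E(B)u,v\rangle_{L^2}$ for Borel $B\subset[0,\infty)$. For $t>0$, $(-\Delta)^t=\int_{[0,\infty)}\lambda^t\,dE(\lambda)$ with domain $H^{2t}(\mathbb{R}^n)=\{u\in L^2(\mathbb{R}^n):\int_{[0,\infty)}\lambda^{2t}\,dE_{u,u}(\lambda)<\infty\}$. The spectral fractional-logarithmic power is $(-\Delta)^{s+\mathrm{Log}}_{\mathrm{spec}}:=\int_{(0,\infty)}\lambda^s\ln\lambda\,dE(\lambda)$, i.e. $\langle(-\Delta)^{s+\mathrm{Log}}_{\mathrm{spec}}u,v\rangle_{L^2}=\int_{(0,\infty)}\lambda^s\ln\lambda\,dE_{u,v}(\lambda)$ for $v\in L^2(\mathbb{R}^n)$ and $u$ in the domain $H^{2s+\mathrm{Log}}(\mathbb{R}^n):=\{u\in L^2(\mathbb{R}^n):\int_{(0,\infty)}\lambda^{2s}\ln^2\lambda\,dE_{u,u}(\lambda)<\infty\}$. *)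

(* Defs.v *)
From HB Require Import structures.
From mathcomp Require Import all_boot all_order all_algebra.
From mathcomp Require Import generic_quotient ring_quotient complex.
From mathcomp Require Import all_classical all_reals all_analysis.

Set Implicit Arguments.
Unset Strict Implicit.
Unset Printing Implicit Defensive.

Import Order.TTheory GRing.Theory Num.Theory.
Import numFieldNormedType.Exports.

Local Open Scope classical_set_scope.
Local Open Scope ring_scope.
Local Open Scope complex_scope.
Local Open Scope quotient_scope.

Section lebesgue_cons.
Context (R : realType) (n : nat).
Local Notation Rn k := (k.-tuple (measurableTypeR R)).

Definition tuple_cons (p : measurableTypeR R * Rn n) : Rn n.+1 :=
  [the Rn n.+1 of p.1 :: p.2].

Definition tuple_uncons (x : Rn n.+1) : measurableTypeR R * Rn n :=
  (tnth x ord0, [tuple of behead x]).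

Lemma tuple_consK : cancel tuple_cons tuple_uncons.
Proof. by case=> a t; congr pair; apply: val_inj. Qed.

Lemma tuple_unconsK : cancel tuple_uncons tuple_cons.
Proof. by move=> x; rewrite [RHS](tuple_eta x); apply: val_inj. Qed.

Lemma measurable_tuple_cons : measurable_fun [set: _] tuple_cons.
Proof. by apply: measurable_cons. Qed.

Lemma measurable_tuple_uncons : measurable_fun [set: _] tuple_uncons.
Proof.
apply: measurable_fun_pair; first exact: measurable_tnth.
exact: measurable_behead.
Qed.

Variable mu : {sigma_finite_measure set (Rn n) -> \bar R}.

(* The product of the one-dimensional Lebesgue measure with [mu], transported
   to tuples. *)
Definition lebesgue_cons : set (Rn n.+1) -> \bar R :=
  pushforward (@lebesgue_measure R \x mu)%E tuple_cons.

Let measurable_preim A : measurable A -> measurable (tuple_cons @^-1` A).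
Proof.
by move=> mA; rewrite -[X in measurable X]setTI; exact: measurable_tuple_cons.
Qed.

Let lebesgue_cons0 : lebesgue_cons set0 = 0%E.
Proof. by rewrite /lebesgue_cons /pushforward preimage_set0 measure0. Qed.

Let lebesgue_cons_ge0 A : (0 <= lebesgue_cons A)%E.
Proof. by rewrite /lebesgue_cons /pushforward; exact: measure_ge0. Qed.

Let lebesgue_cons_sigma_additive : semi_sigma_additive lebesgue_cons.
Proof.
move=> F mF tF mUF; rewrite /lebesgue_cons /pushforward preimage_bigcup.
apply: measure_semi_sigma_additive.
- by move=> k; exact: measurable_preim.
- apply/trivIsetP => /= i j _ _ ij; rewrite -preimage_setI.
  by move/trivIsetP : tF => /(_ _ _ _ _ ij) ->//; rewrite preimage_set0.
- by rewrite -preimage_bigcup; exact: measurable_preim.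
Qed.

HB.instance Definition _ := isMeasure.Build _ _ _ lebesgue_cons
  lebesgue_cons0 lebesgue_cons_ge0 lebesgue_cons_sigma_additive.

Let lebesgue_cons_sigma_finite : sigma_finite [set: Rn n.+1] lebesgue_cons.
Proof.
have /sigma_finiteP[F [TF ndF Foo]] := sigma_finiteT (@lebesgue_measure R).
have /sigma_finiteP[G [TG ndG Goo]] := sigma_finiteT mu.
exists (fun k => tuple_uncons @^-1` (F k `*` G k)).
  apply/esym; rewrite -subTset => x _.
  have [i _ Fi] : (\bigcup_i F i) (tuple_uncons x).1 by rewrite -TF.
  have [j _ Gj] : (\bigcup_i G i) (tuple_uncons x).2 by rewrite -TG.
  exists (maxn i j) => //; split.
    by move: Fi; exact/subsetPset/ndF/leq_maxl.
  by move: Gj; exact/subsetPset/ndG/leq_maxr.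
move=> k; have [mF Fk] := Foo k; have [mG Gk] := Goo k; split.
  rewrite -[X in measurable X]setTI; apply: measurable_tuple_uncons => //.
  exact: measurableX.
rewrite /lebesgue_cons /pushforward -comp_preimage.
have -> : (tuple_uncons \o tuple_cons) @^-1` (F k `*` G k) = F k `*` G k.
  by rewrite (_ : _ \o _ = id)//; apply/funext => p /=; rewrite tuple_consK.
by rewrite product_measure1E// lte_mul_pinfty// ge0_fin_numE.
Qed.

HB.instance Definition _ := Measure_isSigmaFinite.Build _ _ _ lebesgue_cons
  lebesgue_cons_sigma_finite.

End lebesgue_cons.

Section lebesgue_n.
Variable R : realType.

Fixpoint lebesgue_n (n : nat) :
    {sigma_finite_measure set (n.-tuple (measurableTypeR R)) -> \bar R} :=
  if n is k.+1 then lebesgue_cons (lebesgue_n k)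
  else [the {sigma_finite_measure set _ -> \bar R} of
          dirac ([tuple] : 0.-tuple (measurableTypeR R))].

End lebesgue_n.

Definition cintegral d (T : measurableType d) (R : realType)
    (mu : {measure set T -> \bar R}) (f : T -> R[i]) : R[i] :=
  (\int[mu]_x complex.Re (f x))%R +i* (\int[mu]_x complex.Im (f x))%R.

Section L2.
Context d (T : measurableType d) (R : realType).
Variable mu : {measure set T -> \bar R}.

Definition sq_integrable : {pred T -> R[i]} := fun f =>
  ((fun x => complex.Re (f x)) \in Lfun mu 2%:R%:E) &&
  ((fun x => complex.Im (f x)) \in Lfun mu 2%:R%:E).

Let Lfun_lin a (f g : T -> R) : f \in Lfun mu 2%:R%:E -> g \in Lfun mu 2%:R%:E ->
  (fun x => a * f x + g x) \in Lfun mu 2%:R%:E.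
Proof.
have p1 : (1 <= 2%:R%:E :> \bar R)%E by rewrite lee1n.
by move=> mf mg; exact: ((Lfun_submod_closed mu p1).2 a f g mf mg).
Qed.

Let Lfun0 : (fun=> 0) \in Lfun mu 2%:R%:E.
Proof.
have p1 : (1 <= 2%:R%:E :> \bar R)%E by rewrite lee1n.
exact: (Lfun_submod_closed mu p1).1.
Qed.

Lemma sq_integrable_lin a f g : f \in sq_integrable -> g \in sq_integrable ->
  (fun x => a * f x + g x) \in sq_integrable.
Proof.
case: a => a b /andP[f1 f2] /andP[g1 g2]; apply/andP; split.
- have -> : (fun x => complex.Re ((a +i* b) * f x + g x)) =
      (fun x => a * complex.Re (f x) + (- b * complex.Im (f x) + complex.Re (g x))).
    apply/funext => x; case: (f x) (g x) => ? ? [? ?] /=.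
    by rewrite mulNr addrA.
  exact: (Lfun_lin a f1 (Lfun_lin (- b) f2 g1)).
- have -> : (fun x => complex.Im ((a +i* b) * f x + g x)) =
      (fun x => a * complex.Im (f x) + (b * complex.Re (f x) + complex.Im (g x))).
    by apply/funext => x; case: (f x) (g x) => ? ? [? ?] /=; rewrite addrA.
  exact: (Lfun_lin a f2 (Lfun_lin b f1 g2)).
Qed.

Fact sq_integrable_zmod_closed : zmod_closed sq_integrable.
Proof.
have h0 : (fun=> 0 : R[i]) \in sq_integrable by apply/andP.
split=> // f g hf hg.
have -> : f - g = (fun x => - 1 * g x + f x).
  by apply/funext => x; rewrite mulN1r addrC.
exact: sq_integrable_lin.
Qed.

HB.instance Definition _ := GRing.isZmodClosed.Build (T -> R[i]) sq_integrable
  sq_integrable_zmod_closed.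

Record L2fun := MkL2fun {
  L2fun_val :> T -> R[i];
  L2funP : L2fun_val \in sq_integrable }.

HB.instance Definition _ := [isSub for L2fun_val].
HB.instance Definition _ := [Choice of L2fun by <:].
HB.instance Definition _ := [SubChoice_isSubZmodule of L2fun by <:].

Lemma scale_L2fun_subproof (a : R[i]) (f : L2fun) :
  (fun x => a * f x) \in sq_integrable.
Proof.
have -> : (fun x => a * f x) = (fun x => a * f x + (0 : L2fun) x).
  by apply/funext => x; rewrite /= addr0.
exact: (sq_integrable_lin a (L2funP f) (L2funP 0)).
Qed.

Definition scale_L2fun (a : R[i]) (f : L2fun) : L2fun :=
  MkL2fun (scale_L2fun_subproof a f).

Definition null_L2fun : {pred L2fun} :=
  fun f => `[< \forall x \ae mu, f x = 0 >].

Fact null_L2fun_zmod_closed : zmod_closed null_L2fun.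
Proof.
split=> [|f g /asboolP f0 /asboolP g0]; apply/asboolP; first exact: aeW.
apply: filterS2 f0 g0 => x fx0 gx0.
by have -> : (f - g) x = f x - g x by []; rewrite fx0 gx0 subr0.
Qed.

HB.instance Definition _ := GRing.isZmodClosed.Build L2fun null_L2fun
  null_L2fun_zmod_closed.

(* Complex L^2(mu): square-integrable functions modulo a.e. equality. *)
Definition L2 : Type := {ideal_quot null_L2fun}.
HB.instance Definition _ := GRing.Zmodule.on L2.
HB.instance Definition _ := EqQuotient.on L2.

Definition scale_L2 (a : R[i]) (u : L2) : L2 := \pi_L2 (scale_L2fun a (repr u)).

Lemma eq_L2P (f g : L2fun) :
  reflect (\forall x \ae mu, f x = g x) (\pi_L2 f == \pi_L2 g).
Proof.
rewrite -Quotient.idealrBE; apply: (iffP idP) => [/asboolP|fg].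
  by apply: filterS => x /subr0_eq.
apply/asboolP; apply: filterS fg => x fgx.
by have -> : (f - g) x = f x - g x by []; rewrite fgx subrr.
Qed.

Lemma scale_L2_pi a (f : L2fun) : scale_L2 a (\pi_L2 f) = \pi_L2 (scale_L2fun a f).
Proof.
apply/eqP/eq_L2P.
have /eqP/eq_L2P : \pi_L2 (repr (\pi_L2 f)) = \pi_L2 f by rewrite reprK.
apply: filterS => x fx.
exact: (congr1 ( *%R a) fx).
Qed.

Fact scale_L2A a b u : scale_L2 a (scale_L2 b u) = scale_L2 (a * b) u.
Proof.
rewrite -[u]reprK; move: (repr u) => f.
rewrite (scale_L2_pi b) !scale_L2_pi; congr (\pi_L2 _); apply: val_inj.
by apply/funext => x; exact: mulrA.
Qed.

Fact scale_L2_1 : left_id 1 scale_L2.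
Proof.
move=> u; rewrite -[u]reprK; move: (repr u) => f; rewrite !scale_L2_pi; congr (\pi_L2 _); apply: val_inj.
by apply/funext => x; exact: mul1r.
Qed.

Fact scale_L2Dr : right_distributive scale_L2 +%R.
Proof.
move=> a u v; rewrite -[u]reprK -[v]reprK; move: (repr u) (repr v) => f g.
rewrite !scale_L2_pi.
rewrite -!(pi_addr (s := L2)) scale_L2_pi.
congr (\pi_L2 _); apply: val_inj.
by apply/funext => x; exact: mulrDr.
Qed.

Fact scale_L2Dl u : {morph scale_L2^~ u : a b / a + b}.
Proof.
move=> a b; rewrite -[u]reprK; move: (repr u) => f; rewrite !scale_L2_pi -!(pi_addr (s := L2)).
congr (\pi_L2 _); apply: val_inj.
by apply/funext => x; exact: mulrDl.
Qed.

HB.instance Definition _ := GRing.Zmodule_isLmodule.Build R[i] L2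
  scale_L2A scale_L2_1 scale_L2Dr scale_L2Dl.

Definition dotL2 (u v : L2) : R[i] :=
  cintegral mu (fun x => (repr u) x * ((repr v) x)^*).

Definition normL2 (u : L2) : R := Num.sqrt (complex.Re (dotL2 u u)).

End L2.

(* Projection-valued measures on the Borel subsets of [0, +oo[, extended to all
   Borel sets by E(B) = E(B `&` [0, +oo[); the values of [proj] on non-measurable
   sets are irrelevant. *)
Record spectral_measure d (T : measurableType d) (R : realType)
    (mu : {measure set T -> \bar R}) := SpectralMeasure {
  proj :> set (measurableTypeR R) -> L2 mu -> L2 mu;
  proj_linear : forall B, measurable B -> linear (proj B);
  proj_selfadjoint : forall B, measurable B ->
    forall u v, dotL2 (proj B u) v = dotL2 u (proj B v);
  proj_mul : forall A B, measurable A -> measurable B ->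
    forall u, proj A (proj B u) = proj (A `&` B) u;
  proj_set0 : forall u, proj set0 u = 0;
  proj_full : forall u, proj `[0, +oo[ u = u;
  (* weak countable additivity: every B |-> <E(B) u, v> is a complex measure *)
  proj_sigma_additive : forall F : nat -> set (measurableTypeR R),
    (forall k, measurable (F k)) -> trivIset setT F -> forall u v,
    (fun N => \sum_(0 <= k < N) complex.Re (dotL2 (proj (F k) u) v)) @ \oo -->
      complex.Re (dotL2 (proj (\bigcup_k F k) u) v) /\
    (fun N => \sum_(0 <= k < N) complex.Im (dotL2 (proj (F k) u) v)) @ \oo -->
      complex.Im (dotL2 (proj (\bigcup_k F k) u) v) }.

Section spectral_charges.
Context d (T : measurableType d) (R : realType) (mu : {measure set T -> \bar R}).
Variable E : spectral_measure mu.

Section uv.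
Variables u v : L2 mu.

Definition spectral_Re (B : set (measurableTypeR R)) : \bar R :=
  (complex.Re (dotL2 (E B u) v))%:E.

Definition spectral_Im (B : set (measurableTypeR R)) : \bar R :=
  (complex.Im (dotL2 (E B u) v))%:E.

Let sum_cst_cvg (c l : R) :
  (fun N => \sum_(0 <= k < N) c) @ \oo --> l -> c = 0.
Proof.
move=> h.
have h1 : (fun N => \sum_(0 <= k < N.+1) c) @ \oo --> l.
  by rewrite -cvg_shiftS in h.
have : (fun N => \sum_(0 <= k < N.+1) c - \sum_(0 <= k < N) c) @ \oo --> l - l.
  exact: cvgB.
under eq_fun do rewrite big_nat_recr//= addrAC subrr add0r.
by rewrite subrr => /cvg_lim <- //; rewrite lim_cst.
Qed.

Let spectral_Re0 : spectral_Re set0 = 0%E.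
Proof.
have m0 : forall k : nat, measurable (set0 : set (measurableTypeR R)) by [].
have [h _] := @proj_sigma_additive _ _ _ _ E (fun=> set0) m0 (@trivIset_set0 _ _ _) u v.
by congr EFin; exact: sum_cst_cvg h.
Qed.

Let spectral_Im0 : spectral_Im set0 = 0%E.
Proof.
have m0 : forall k : nat, measurable (set0 : set (measurableTypeR R)) by [].
have [_ h] := @proj_sigma_additive _ _ _ _ E (fun=> set0) m0 (@trivIset_set0 _ _ _) u v.
by congr EFin; exact: sum_cst_cvg h.
Qed.

Let spectral_Re_additive : semi_sigma_additive spectral_Re.
Proof.
move=> F mF tF _; have [h _] := proj_sigma_additive E mF tF u v.
under eq_fun do rewrite sumEFin.
by apply: cvg_EFin; [exact: nearW|exact: h].
Qed.

Let spectral_Im_additive : semi_sigma_additive spectral_Im.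
Proof.
move=> F mF tF _; have [_ h] := proj_sigma_additive E mF tF u v.
under eq_fun do rewrite sumEFin.
by apply: cvg_EFin; [exact: nearW|exact: h].
Qed.

HB.instance Definition _ := isCharge.Build _ _ _ spectral_Re
  spectral_Re0 (fun _ _ => isT) spectral_Re_additive.

HB.instance Definition _ := isCharge.Build _ _ _ spectral_Im
  spectral_Im0 (fun _ _ => isT) spectral_Im_additive.

End uv.

Lemma dotL2_ge0 (u : L2 mu) : 0 <= complex.Re (dotL2 u u).
Proof.
apply: Rintegral_ge0 => x _; case: (repr u x) => a b /=.
by rewrite mulrN opprK addr_ge0// -expr2 sqr_ge0.
Qed.

Section diagonal.
Variable u : L2 mu.

(* [crestr0 _ measurableT] only resets the values on non-measurable sets to 0. *)
Let diag_ge0 B : (0 <= crestr0 (spectral_Re u u) (@measurableT _ _) B)%E.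
Proof.
rewrite /crestr0; case: ifPn => //; rewrite inE => mB.
rewrite /crestr setIT /spectral_Re lee_fin -{1}(setIid B) -proj_mul//.
by rewrite proj_selfadjoint// dotL2_ge0.
Qed.

(* The finite positive measure E_{u,u}. *)
Definition spectral_diag : {measure set (measurableTypeR R) -> \bar R} :=
  measure_of_charge _ diag_ge0.

End diagonal.

End spectral_charges.

(* Integral against a charge, through its Jordan decomposition; the result does
   not depend on the Hahn decomposition that is picked. *)
Definition charge_integral d (T : measurableType d) (R : realType)
    (nu : {charge set T -> \bar R}) (D : set T) (f : T -> R) : R :=
  let P := cid (Hahn_decomposition nu) in
  let N := cid (projT2 P) in
  (\int[jordan_pos (projT2 N)]_(x in D) f x)%R -
  (\int[jordan_neg (projT2 N)]_(x in D) f x)%R.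

Section spectral_integral.
Context d (T : measurableType d) (R : realType) (mu : {measure set T -> \bar R}).
Variables (E : spectral_measure mu) (D : set (measurableTypeR R)) (f : R -> R).

(* The integral of f over D against the complex measure
   E_{u,v} = spectral_Re + i spectral_Im. *)
Definition spectral_integral (u v : L2 mu) : R[i] :=
  charge_integral (spectral_Re E u v) D f +i*
  charge_integral (spectral_Im E u v) D f.

Definition spectral_dom : set (L2 mu) :=
  [set u | (\int[spectral_diag E u]_(x in D) (f x ^+ 2)%:E < +oo)%E].

(* The graph of the possibly unbounded operator \int_D f dE. *)
Definition spectral_graph (u w : L2 mu) : Prop :=
  spectral_dom u /\ forall v, dotL2 w v = spectral_integral u v.

(* The same operator as a total function, with value 0 off its domain. *)
Definition spectral_op (u : L2 mu) : L2 mu := xget 0 (spectral_graph u).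

End spectral_integral.

Section Laplacian.
Context (R : realType) (n : nat).

Local Notation L2n := (L2 (lebesgue_n R n)).

Definition partial (i : 'I_n) (phi : 'rV[R]_n -> R) : 'rV[R]_n -> R :=
  'D_(delta_mx 0 i) phi.

Definition smooth (phi : 'rV[R]_n -> R) : Prop :=
  forall (s : seq 'I_n) x, differentiable (foldr partial phi s) x.

Definition test_function (phi : 'rV[R]_n -> R) : Prop :=
  smooth phi /\ compact (closure [set x | phi x != 0]).

Definition classical_Laplacian (phi : 'rV[R]_n -> R) : 'rV[R]_n -> R :=
  fun x => \sum_(i < n) partial i (partial i phi) x.

(* The distributional pairing of u with phi. The library has the measurable
   structure of R^n on tuples and its differential structure on row vectors. *)
Definition pairing (u : L2n) (phi : 'rV[R]_n -> R) : R[i] :=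
  cintegral (lebesgue_n R n)
    (fun x => repr u x * (phi (\row_i tnth x i))%:C).

(* The graph of the self-adjoint operator -Delta: its domain is
   H^2(R^n) = {u in L^2 | Delta u in L^2}, with Delta u in the sense of
   distributions; real test functions determine complex distributions. *)
Definition neg_Laplacian (u w : L2n) : Prop :=
  forall phi, test_function phi ->
    pairing w phi = - pairing u (classical_Laplacian phi).

(* -Delta = \int_[0, +oo[ lambda dE(lambda), domains included. *)
Definition spectral_resolution (E : spectral_measure (lebesgue_n R n)) : Prop :=
  forall u w : L2n, neg_Laplacian u w <-> spectral_graph E `[0, +oo[ id u w.

Variable E : spectral_measure (lebesgue_n R n).

(* [sobolev2 t] is H^{2t}(R^n), the domain of (-Delta)^t. *)
Definition sobolev2 (t : R) : set L2n :=
  spectral_dom E `[0, +oo[ (fun l => l `^ t).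

Definition frac_Laplacian (t : R) : L2n -> L2n :=
  spectral_op E `[0, +oo[ (fun l => l `^ t).

(* [sobolev2_log s] is H^{2s+Log}(R^n). *)
Definition sobolev2_log (s : R) : set L2n :=
  spectral_dom E `]0, +oo[ (fun l => l `^ s * ln l).

Definition frac_log_Laplacian (s : R) : L2n -> L2n :=
  spectral_op E `]0, +oo[ (fun l => l `^ s * ln l).

End Laplacian.

(* Main.v *)
Require Import Defs.
From mathcomp Require Import finmap.
From mathcomp Require Import all_boot all_order all_algebra.
From mathcomp Require Import generic_quotient ring_quotient complex.
From mathcomp Require Import all_classical all_reals all_analysis.
From mathcomp Require Import measurable_realfun ring lra.

(** Write [m] for the finite measure [E_{u,u}]. A spectral integral of a real
    symbol [f] satisfies [|(\int f dE) u| ^ 2 <= 4 * \int f ^ 2 dm]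
    ([represents_norm]), so the claim reduces to the convergence to 0, in
    [L^2(m)], of
      [F_t(l) = (l ^ t - l ^ s) / (t - s) - l ^ s * ln l]  as [t] tends to [s].
    With [h = t - s] and [L = ln l] one has
      [F_t(l) = exp(s L) * (exp(h L) - 1 - h L) / h],
    and Taylor's formula bounds this by [|h| * L ^ 2 * exp(s L + |h L|)]. The
    factor [L ^ 2] is absorbed by a multiple of [exp(d |L|)]; for
    [|h| <= d] with [2 d <= s] and [s + 2 d <= s0] the resulting exponent
    [s L + 2 d |L|] is at most 0 when [L < 0] and at most [s0 L] otherwise.
    Hence [|F_t(l)| <= |t - s| * K * (1 + l ^ s0)] ([difference_quotient_le]).
    Since [m] is finite and [u] belongs to [H^{2 s0}], the function
    [1 + l ^ s0] is in [L^2(m)], and the norm in the theorem is [O(|t - s|)].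

    The operators are defined as the vector, if there is one, that represents a
    family of integrals against the complex measures [E_{u,v}]. The work is
    therefore to show that such a vector exists and depends linearly on the
    symbol. For a simple function [h] the vector is the finite sum
    [\sum_y y E(h = y) u], and [h |-> step_op h] is an isometry from [L^2(m)]
    into [L^2(mu)] ([step_op_isometry]). A nonnegative symbol in [L^2(m)] is an
    increasing limit of simple functions; by the isometry and the completeness
    of [L^2(mu)] ([riesz_fischer], [L2_complete]) their vectors converge, and
    monotone convergence identifies the limit ([nonneg_spectral_vector]).

    Two observations keep this real and positive. First,
    [Im <x, v> = Re <x, i v>], so that the real inner product [rdot] carries
    all the information. Second, if [P] is a Hahn set of the charge
    [A |-> Re <E(A) u, v>], then its positive part is
    [A |-> Re <E(A) u, E(P) v>]: the Jordan parts of [E_{u,v}] have the same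
    form as [E_{u,v}], with another [v]
    ([charge_integral_represents]). So it is enough to test a vector against
    positive measures of that form, where integrals of nonnegative functions
    need no integrability hypothesis. *)

Set Implicit Arguments.
Unset Strict Implicit.
Unset Printing Implicit Defensive.

Import Order.TTheory GRing.Theory Num.Theory.
Import numFieldNormedType.Exports.

Local Open Scope classical_set_scope.
Local Open Scope ring_scope.
Local Open Scope complex_scope.

(** * Completeness of the real space L^2 *)

Section square_integrable.
Context d (T : measurableType d) (R : realType).
Variable mu : {measure set T -> \bar R}.
Implicit Types f g : T -> R.

Lemma Lfun2P f : f \in Lfun mu 2%:R%:E <->
  measurable_fun setT f /\ (\int[mu]_x (f x ^+ 2)%:E < +oo)%E.
Proof.
have two0 : (2 : R) != 0 by rewrite pnatr_eq0.
have e2 : ('N[mu]_2%:R%:E[EFin \o f] `^ 2 = \int[mu]_x (f x ^+ 2)%:E)%E.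
  rewrite poweR_Lnorm//; apply: eq_integral => x _.
  by rewrite /= powR_mulrn// real_normK// num_real.
split.
  rewrite inE => /andP[]; rewrite !inE/= => mf ff; split=> //.
  by rewrite -e2 poweR_lty.
move=> [mf ff]; rewrite inE; apply/andP; split; rewrite inE//=.
rewrite /finite_norm (@lty_poweRy _ _ 2)//.
by rewrite e2.
Qed.

Lemma integral_sqr_le f g : measurable_fun setT f -> measurable_fun setT g ->
  (\int[mu]_x (f x ^+ 2)%:E <=
   2%:E * \int[mu]_x ((f x - g x) ^+ 2)%:E + 2%:E * \int[mu]_x (g x ^+ 2)%:E)%E.
Proof.
move=> mf mg.
have sq0 (h : T -> R) x : setT x -> (0 <= (h x ^+ 2)%:E)%E.
  by move=> _; rewrite lee_fin sqr_ge0.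
have mB : measurable_fun setT (fun x => ((f x - g x) ^+ 2)%:E).
  by apply/measurable_EFinP; apply: measurable_funX; exact: measurable_funB.
have mf2 : measurable_fun setT (fun x => (f x ^+ 2)%:E).
  by apply/measurable_EFinP; exact: measurable_funX.
have mg2 : measurable_fun setT (fun x => (g x ^+ 2)%:E).
  by apply/measurable_EFinP; exact: measurable_funX.
rewrite -!ge0_integralZl//; try by [exact: sq0 | exact: (sq0 (f \- g))].
have m2 (h : T -> \bar R) : measurable_fun setT h ->
    measurable_fun setT (fun x => 2%:E * h x)%E.
  by move=> mh; exact: emeasurable_funM.
have p2 (h : T -> R) x : setT x -> (0 <= 2%:E * (h x ^+ 2)%:E)%E.
  by move=> _; rewrite -EFinM lee_fin mulr_ge0 ?sqr_ge0.
rewrite -ge0_integralD//; last 4 first.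
- exact: (p2 (f \- g)).
- exact: m2.
- exact: p2.
- exact: m2.
apply: ge0_le_integral => //.
- exact: sq0.
- by apply: emeasurable_funD; exact: m2.
- move=> x _; rewrite -!EFinM -EFinD lee_fin.
  by have := sqr_ge0 (f x - 2 * g x); lra.
Qed.

Lemma limn_einf_le (a : nat -> \bar R) (J : nat) (e : \bar R) :
  (forall j, (J <= j)%N -> (a j <= e)%E) -> (limn_einf a <= e)%E.
Proof.
move=> ae; rewrite limn_einf_lim; apply: lime_le; first exact: is_cvg_einfs.
apply: nearW => n; apply: (@le_trans _ _ (a (maxn n J))).
  by apply: ereal_inf_lbound; exists (maxn n J) => //=; exact: leq_maxl.
by apply: ae; exact: leq_maxr.
Qed.

(** The weight [4 ^ j] turns square summability into geometric decay
    [|a_{j+1} - a_j| = O(2 ^ -j)], hence absolute summability. *)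
Lemma cvg_square_summable_increments (a : nat -> R) :
  (\sum_(j <oo) (4 ^+ j * (a j.+1 - a j) ^+ 2)%:E < +oo)%E -> cvgn a.
Proof.
set S := (\sum_(j <oo) _)%E => Soo.
have S0 : (0 <= S)%E.
  apply: nneseries_ge0 => j _ _.
  by rewrite lee_fin mulr_ge0 ?sqr_ge0 ?exprn_ge0.
pose C := fine S.
have C0 : 0 <= C by exact: fine_ge0.
have CS : (C%:E = S)%E by rewrite fineK// ge0_fin_numE.
have aC j : `|a j.+1 - a j| <= geometric (C + 1) 2^-1 j.
  have tj : 4 ^+ j * (a j.+1 - a j) ^+ 2 <= C.
    rewrite -lee_fin CS; apply: le_trans (nneseries_lim_ge j.+1 _); last first.
      by move=> k _; rewrite lee_fin mulr_ge0 ?sqr_ge0 ?exprn_ge0.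
    rewrite big_mkord big_ord_recr/= leeDr// sume_ge0// => k _.
    by rewrite lee_fin mulr_ge0 ?sqr_ge0 ?exprn_ge0.
  rewrite /geometric/=; set x := `| _ |; have x0 : 0 <= x by exact: normr_ge0.
  have {}tj : (2 ^+ j * x) ^+ 2 <= (C + 1) ^+ 2.
    rewrite exprMn /x real_normK ?num_real// -exprM mulnC exprM.
    have -> : (2 : R) ^+ 2 = 4 by rewrite expr2 -natrM.
    (* [C <= (C + 1) ^ 2] replaces a square root of [C]. *)
    by apply: (le_trans tj); nra.
  move: tj; rewrite ler_sqr ?nnegrE ?mulr_ge0 ?exprn_ge0 ?addr_ge0// => tj.
  by rewrite exprVn ler_pdivlMr ?exprn_gt0// mulrC.
have /cvg_ex[l cl] : cvgn (series (fun j => a j.+1 - a j)).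
  apply: normed_cvg; apply: (@series_le_cvg _ _ (geometric (C + 1) 2^-1)) => //.
  - by move=> j /=.
  - by move=> j; rewrite /geometric/= mulr_ge0 ?exprn_ge0 ?addr_ge0.
  - by apply: is_cvg_geometric_series; rewrite ger0_norm// invf_lt1// ltr1n.
apply/cvg_ex; exists (a 0%N + l).
rewrite [X in X @ _ --> _](_ : _ =
    (fun n => a 0%N + series (fun j => a j.+1 - a j) n)); last first.
  by apply/funext => n; rewrite /series/= telescope_sumr// addrC subrK.
by apply: cvgD; [exact: cvg_cst|exact: cl].
Qed.

(** The Riesz-Fischer theorem. Along a subsequence whose increments have squared
    norm at most [8 ^ -j], the series of their squares weighted by [4 ^ j] has a
    finite integral, hence is finite almost everywhere, and the subsequence
    converges there. Fatou's lemma transfers the Cauchy estimate to the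
    limit. *)
Lemma riesz_fischer (g : nat -> T -> R) :
  (forall k, g k \in Lfun mu 2%:R%:E) ->
  (forall e, 0 < e -> exists N, forall n k, (N <= n)%N -> (N <= k)%N ->
     (\int[mu]_x ((g k x - g n x) ^+ 2)%:E <= e%:E)%E) ->
  exists2 h, h \in Lfun mu 2%:R%:E &
    forall e, 0 < e -> exists N, forall n, (N <= n)%N ->
     (\int[mu]_x ((h x - g n x) ^+ 2)%:E <= e%:E)%E.
Proof.
move=> g2 gC.
have mg k : measurable_fun setT (g k) by have /Lfun2P[] := g2 k.
have e0 j : 0 < (8^-1 : R) ^+ j by rewrite exprn_gt0.
have {e0} := fun j => cid (gC _ (e0 j)).
move=> /all_sig[N HN].
(* The subsequence is large enough for the [j]-th and the [(j+1)]-th terms to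
   satisfy the Cauchy estimate [8 ^ -j], and it tends to infinity. *)
pose psi j := (j + \max_(i < j.+1) N i)%N.
have psiN j : (N j <= psi j)%N.
  apply: leq_trans (leq_addl _ _).
  exact: (leq_bigmax (F := fun i : 'I_j.+1 => N i) ord_max).
have psiSN j : (N j <= psi j.+1)%N.
  apply: leq_trans (leq_addl _ _); rewrite big_ord_recr/=.
  apply: leq_trans (leq_maxl _ _).
  exact: (leq_bigmax (F := fun i : 'I_j.+1 => N i) ord_max).
have jpsi j : (j <= psi j)%N by exact: leq_addr.
pose dsq j x := 4 ^+ j * (g (psi j.+1) x - g (psi j) x) ^+ 2.
have dsq0 j x : 0 <= dsq j x by rewrite mulr_ge0 ?sqr_ge0 ?exprn_ge0.
have mdsq j : measurable_fun setT (dsq j).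
  apply: measurable_funM => //.
  by apply: measurable_funX; exact: measurable_funB.
pose S x := (\sum_(j <oo) (dsq j x)%:E)%E.
have S0 x : (0 <= S x)%E by apply: nneseries_ge0 => j _ _; rewrite lee_fin.
have mS : measurable_fun setT S.
  apply: (@ge0_emeasurable_sum _ _ _ setT (fun j x => (dsq j x)%:E) xpredT).
    by move=> j x _ _; rewrite lee_fin.
  by move=> j _; apply/measurable_EFinP.
have iS : mu.-integrable setT S.
  apply/integrableP; split=> //.
  under eq_integral do rewrite gee0_abs//.
  rewrite /S integral_nneseries//; last 2 first.
    by move=> j; apply/measurable_EFinP.
    by move=> j x _; rewrite lee_fin.
  apply: (@le_lt_trans _ _ (\sum_(j <oo) (2 / (2 ^ (j + 1))%:R)%:E)%E).
    apply: lee_nneseries => [j _ _|j _].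
      by apply: integral_ge0 => x _; rewrite lee_fin.
    rewrite /dsq; under eq_integral do rewrite EFinM.
    rewrite ge0_integralZl//; last 2 first.
      by apply/measurable_EFinP; apply: measurable_funX; exact: measurable_funB.
      by move=> x _; rewrite lee_fin sqr_ge0.
    apply: (@le_trans _ _ ((4 ^+ j)%:E * ((8^-1) ^+ j)%:E)%E).
      by apply: lee_wpmul2l; [rewrite lee_fin exprn_ge0|apply: HN].
    rewrite -EFinM lee_fin -exprMn addn1 natrX exprS invfM mulrA.
    rewrite divff ?mul1r ?pnatr_eq0// -exprVn.
    by have -> : (4 * 8^-1 : R) = 2^-1 by lra.
  have /cvg_lim -> // := @cvg_geometric_eseries_half R 2 0.
  by rewrite ltry.
pose A := [set x | S x \is a fin_num].
have mA : measurable A by rewrite -[A]setTI; exact: emeasurable_fin_num.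
have aeA : {ae mu, forall x, A x}.
  by have := integrable_ae measurableT iS; apply: filterS => x /(_ I).
(* Cutting off outside [A] gives convergence everywhere, which makes the
   pointwise limit measurable. *)
pose g' j x := (\1_A x : R) * g (psi j) x.
have cg' x : cvgn (g' ^~ x).
  rewrite /g' indicE; case: (boolP (x \in A)) => [|xA].
    rewrite inE /= => Ax.
    rewrite (_ : (fun j => _) = (fun j => g (psi j) x)); last first.
      by apply/funext => j; rewrite mul1r.
    apply: cvg_square_summable_increments.
    by move: Ax; rewrite /A/= ge0_fin_numE.
  rewrite (_ : (fun j => _) = cst 0); first exact: is_cvg_cst.
  by apply/funext => j; rewrite mul0r.
pose h x := limn (g' ^~ x).
have mh : measurable_fun setT h.
  apply: (@measurable_fun_cvg _ _ _ setT g') => [j|x _]; last exact: cg'.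
  by apply: measurable_funM => //; exact: measurable_indic.
have hg e : 0 < e -> exists N, forall n, (N <= n)%N ->
     (\int[mu]_x ((h x - g n x) ^+ 2)%:E <= e%:E)%E.
  move=> e0; have [M HM] := gC _ e0; exists M => n Mn.
  have -> : (\int[mu]_x ((h x - g n x) ^+ 2)%:E =
     \int[mu]_x limn_einf (fun j => ((g (psi j) x - g n x) ^+ 2)%:E))%E.
    apply: ae_eq_integral => //.
    - by apply/measurable_EFinP; apply: measurable_funX; exact: measurable_funB.
    - rewrite /limn_einf; apply: measurableT_comp => //.
      apply: measurable_fun_limn_esup => j; apply: measurableT_comp => //.
      by apply/measurable_EFinP; apply: measurable_funX; exact: measurable_funB.
    - apply: filterS aeA => x Ax _; apply/esym.
      have cg : g (psi j) x @[j --> \oo] --> h x.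
        have := cg' x; rewrite /h /g' indicE mem_set//.
        by under eq_fun do rewrite mul1r.
      suff cg2 : ((g (psi j) x - g n x) ^+ 2)%:E @[j --> \oo] -->
          ((h x - g n x) ^+ 2)%:E.
        by rewrite (cvg_limn_einf_sup cg2).1.
      apply: cvg_EFin; first exact: nearW.
      under [X in X @ _ --> _]eq_fun do rewrite /= expr2.
      by rewrite expr2; apply: cvgM; apply: cvgB => //; exact: cvg_cst.
  apply: (le_trans (fatou _ _ _ _)) => //.
  - move=> j; apply/measurable_EFinP.
    by apply: measurable_funX; exact: measurable_funB.
  - by move=> j x _; rewrite lee_fin sqr_ge0.
  apply: (@limn_einf_le _ M) => j Mj; apply: HM => //.
  exact: leq_trans (jpsi j).
exists h => //; apply/Lfun2P; split => //.
have [M /(_ M (leqnn _)) HM] := hg 1 ltr01.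
have /Lfun2P[_ gM] := g2 M.
apply: le_lt_trans (integral_sqr_le mh (mg M)) _.
by rewrite lte_add_pinfty// lte_mul_pinfty// (le_lt_trans HM)// ltry.
Qed.

End square_integrable.

(** * The real inner product on complex L^2 *)

Section real_inner_product.
Local Open Scope quotient_scope.
Context d (T : measurableType d) (R : realType).
Variable mu : {measure set T -> \bar R}.
Implicit Types (f g : L2fun mu) (u v w : L2 mu).

Definition rdot u v : R := complex.Re (dotL2 u v).

Definition pointwise_dot (f g : T -> R[i]) (x : T) : R :=
  complex.Re (f x) * complex.Re (g x) + complex.Im (f x) * complex.Im (g x).

Lemma L2fun_Re f : (fun x => complex.Re (f x)) \in Lfun mu 2%:R%:E.
Proof. by have /andP[] := L2funP f. Qed.

Lemma L2fun_Im f : (fun x => complex.Im (f x)) \in Lfun mu 2%:R%:E.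
Proof. by have /andP[] := L2funP f. Qed.

Lemma integrable_pointwise_dot f g :
  mu.-integrable setT (EFin \o pointwise_dot f g).
Proof.
have := integrableD measurableT
  (iffLR (Lfun1_integrable _ _) (Lfun2_mul_Lfun1 (L2fun_Re f) (L2fun_Re g)))
  (iffLR (Lfun1_integrable _ _) (Lfun2_mul_Lfun1 (L2fun_Im f) (L2fun_Im g))).
by [].
Qed.

Lemma repr_pi_ae f : \forall x \ae mu, repr (\pi_(L2 mu) f) x = f x.
Proof. by apply/eq_L2P; rewrite reprK. Qed.

(** The pairing of two classes is computed on any representatives: the
    definition goes through the chosen ones, which are equal to them almost
    everywhere. *)
Lemma rdot_pi f g :
  rdot (\pi_(L2 mu) f) (\pi_(L2 mu) g) = \int[mu]_x pointwise_dot f g x.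
Proof.
rewrite /rdot /dotL2 /cintegral/= /Rintegral; congr fine.
apply: ae_eq_integral => //.
- rewrite (_ : (fun x => _) = EFin \o
      pointwise_dot (repr (\pi_(L2 mu) f)) (repr (\pi_(L2 mu) g))).
    by have /integrableP[] := integrable_pointwise_dot
      (repr (\pi_(L2 mu) f)) (repr (\pi_(L2 mu) g)).
  apply/funext => x; rewrite /pointwise_dot/=.
  by case: (_ x) => ? ?; case: (_ x) => ? ? /=; rewrite mulrN opprK.
- by have /integrableP[] := integrable_pointwise_dot f g.
apply: filterS2 (repr_pi_ae f) (repr_pi_ae g) => x -> -> _.
rewrite /pointwise_dot; case: (f x) => ? ?; case: (g x) => ? ? /=.
by rewrite mulrN opprK.
Qed.

Lemma rdotC u v : rdot u v = rdot v u.
Proof.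
rewrite -[u]reprK -[v]reprK !rdot_pi; apply: eq_Rintegral => x _.
by rewrite /pointwise_dot mulrC [X in _ + X]mulrC.
Qed.

Lemma rdotDl u v w : rdot (u + v) w = rdot u w + rdot v w.
Proof.
rewrite -[u]reprK -[v]reprK -[w]reprK.
move: (repr u) (repr v) (repr w) => f g h.
rewrite -(pi_addr (s := L2 mu)) !rdot_pi -RintegralD//; last 2 first.
- exact: integrable_pointwise_dot.
- exact: integrable_pointwise_dot.
apply: eq_Rintegral => x _; rewrite /pointwise_dot.
rewrite [L2fun_val (f + g) x](_ : _ = f x + g x)//.
by case: (f x) (g x) => ? ? [? ?] /=; lra.
Qed.

Lemma rdotZl (a : R) u v : rdot (a%:C *: u) v = a * rdot u v.
Proof.
rewrite -[u]reprK -[v]reprK; move: (repr u) (repr v) => f h.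
have -> : a%:C *: \pi_(L2 mu) f = \pi_(L2 mu) (scale_L2fun a%:C f).
  exact: scale_L2_pi.
rewrite !rdot_pi -RintegralZl//; last exact: integrable_pointwise_dot.
apply: eq_Rintegral => x _; rewrite /pointwise_dot/=.
by case: (f x) => ? ? /=; lra.
Qed.

(** The imaginary part of the Hermitian product is recovered from the real
    inner product, since the product is conjugate-linear on the right. *)
Lemma Im_dotL2 u v : complex.Im (dotL2 u v) = rdot u ('i *: v).
Proof.
rewrite -[u]reprK -[v]reprK; move: (repr u) (repr v) => f h.
have -> : 'i *: \pi_(L2 mu) h = \pi_(L2 mu) (scale_L2fun 'i h).
  exact: scale_L2_pi.
rewrite rdot_pi /dotL2 /cintegral /= /Rintegral; congr fine.
have mm (f1 g1 f2 g2 : T -> R) :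
    f1 \in Lfun mu 2%:R%:E -> g1 \in Lfun mu 2%:R%:E ->
    f2 \in Lfun mu 2%:R%:E -> g2 \in Lfun mu 2%:R%:E ->
    measurable_fun setT (fun x => (f1 x * g1 x - f2 x * g2 x)%:E).
  move=> /Lfun2P[m1 _] /Lfun2P[m2 _] /Lfun2P[m3 _] /Lfun2P[m4 _].
  apply/measurable_EFinP.
  by apply: measurable_funB; exact: measurable_funM.
apply: ae_eq_integral => //.
- pose f' := repr (\pi_(L2 mu) f); pose h' := repr (\pi_(L2 mu) h).
  rewrite (_ : (fun x => _) = (fun x =>
      (complex.Im (f' x) * complex.Re (h' x) -
       complex.Re (f' x) * complex.Im (h' x))%:E)).
    apply: mm; [exact: L2fun_Im|exact: L2fun_Re|exact: L2fun_Re|].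
    exact: L2fun_Im.
  apply/funext => x; case: (_ x) => ? ?; case: (_ x) => ? ? /=; congr EFin; lra.
- by have /integrableP[] := integrable_pointwise_dot f (scale_L2fun 'i h).
apply: filterS2 (repr_pi_ae f) (repr_pi_ae h) => x -> -> _.
rewrite /pointwise_dot/=; case: (f x) => ? ?; case: (h x) => ? ? /=.
by congr EFin; lra.
Qed.

Lemma rdotDr u v w : rdot u (v + w) = rdot u v + rdot u w.
Proof. by rewrite rdotC rdotDl !(rdotC u). Qed.

Lemma rdotZr (a : R) u v : rdot u (a%:C *: v) = a * rdot u v.
Proof. by rewrite rdotC rdotZl rdotC. Qed.

Lemma rdotNl u v : rdot (- u) v = - rdot u v.
Proof.
have -> : - u = (-1)%:C *: u by rewrite rmorphN1 scaleN1r.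
by rewrite rdotZl mulN1r.
Qed.

Lemma rdotBl u v w : rdot (u - v) w = rdot u w - rdot v w.
Proof. by rewrite rdotDl rdotNl. Qed.

Lemma rdotBr u v w : rdot u (v - w) = rdot u v - rdot u w.
Proof. by rewrite rdotC rdotBl !(rdotC u). Qed.

Lemma rdotNr u v : rdot u (- v) = - rdot u v.
Proof. by rewrite rdotC rdotNl rdotC. Qed.

Lemma rdot0l v : rdot 0 v = 0.
Proof. by rewrite -(subrr 0) rdotBl subrr. Qed.

Lemma rdot_suml (I : Type) (s : seq I) (F : I -> L2 mu) v :
  rdot (\sum_(i <- s) F i) v = \sum_(i <- s) rdot (F i) v.
Proof.
apply: (big_morph (fun u => rdot u v)) => [u w|]; [exact: rdotDl|exact: rdot0l].
Qed.

Lemma rdot_sumr (I : Type) (s : seq I) (F : I -> L2 mu) v :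
  rdot v (\sum_(i <- s) F i) = \sum_(i <- s) rdot v (F i).
Proof. by rewrite rdotC rdot_suml; apply: eq_bigr => i _; rewrite rdotC. Qed.

Lemma rdot_ge0 u : 0 <= rdot u u. Proof. exact: dotL2_ge0. Qed.

Lemma rdot_eq0 u : rdot u u = 0 -> u = 0.
Proof.
rewrite -[u]reprK; move: (repr u) => f; rewrite rdot_pi => f0.
have -> : (0 : L2 mu) = \pi_(L2 mu) 0 by rewrite pi_zeror.
have p0 x : 0 <= pointwise_dot f f x.
  by rewrite /pointwise_dot -!expr2 addr_ge0 ?sqr_ge0.
have i0 : (\int[mu]_x `|(pointwise_dot f f x)%:E| = 0)%E.
  under eq_integral do rewrite gee0_abs ?lee_fin//.
  rewrite -[LHS]fineK.
    by rewrite -[fine _]/(\int[mu]_x pointwise_dot f f x) f0.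
  exact: (integrable_fin_num measurableT (integrable_pointwise_dot f f)).
have mp : measurable_fun setT (EFin \o pointwise_dot f f).
  by have /integrableP[] := integrable_pointwise_dot f f.
have := iffLR (ae_eq_integral_abs mu measurableT mp) i0.
move=> h; apply/eqP/eq_L2P; apply: filterS h => x /(_ I) [h].
suff fx0 : f x = 0 by [].
move: h; rewrite /pointwise_dot; case: (f x) => a b /= h.
have [-> ->//] : a = 0 /\ b = 0.
by split; apply/eqP; rewrite -sqrf_eq0; apply/eqP; nra.
Qed.

Lemma rdot_inj u w : (forall v, rdot u v = rdot w v) -> u = w.
Proof.
move=> uw; apply/eqP; rewrite -subr_eq0; apply/eqP/rdot_eq0.
by rewrite rdotBl uw subrr.
Qed.

Lemma rdot_cauchy_schwarz u v : (rdot u v) ^+ 2 <= rdot u u * rdot v v.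
Proof.
have [v0|vN0] := eqVneq (rdot v v) 0.
  by rewrite v0 (rdot_eq0 v0) rdotC rdot0l expr0n mulr0.
have vgt0 : 0 < rdot v v by rewrite lt_def vN0 rdot_ge0.
(* [rdot v v] times the component of [u] orthogonal to [v]. *)
have := rdot_ge0 ((rdot v v)%:C *: u - (rdot u v)%:C *: v).
rewrite rdotBl !rdotBr !rdotZl !rdotZr (rdotC v u).
set a := rdot u u; set b := rdot u v; set c := rdot v v => h.
have : 0 <= c * (a * c - b ^+ 2) by move: h; lra.
by rewrite pmulr_rge0// subr_ge0.
Qed.

Lemma rdot_sqrB_le u v : rdot (u - v) (u - v) <= 2 * rdot u u + 2 * rdot v v.
Proof.
have := rdot_ge0 (u + v).
by rewrite !(rdotDl, rdotDr, rdotNl, rdotNr) (rdotC v u); lra.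
Qed.

Lemma rdot_sqrB_pi f g :
  ((rdot (\pi_(L2 mu) f - \pi_(L2 mu) g) (\pi_(L2 mu) f - \pi_(L2 mu) g))%:E =
   \int[mu]_x ((complex.Re (f x) - complex.Re (g x)) ^+ 2)%:E +
   \int[mu]_x ((complex.Im (f x) - complex.Im (g x)) ^+ 2)%:E)%E.
Proof.
rewrite -(pi_oppr (s := L2 mu)) -(pi_addr (s := L2 mu)) rdot_pi /Rintegral.
rewrite fineK; last first.
  exact: (integrable_fin_num measurableT (integrable_pointwise_dot _ _)).
have mRI (h k : T -> R) : h \in Lfun mu 2%:R%:E ->
    k \in Lfun mu 2%:R%:E ->
    measurable_fun setT (fun x => ((h x - k x) ^+ 2)%:E).
  move=> /Lfun2P[mh _] /Lfun2P[mk _].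
  by apply/measurable_EFinP; apply: measurable_funX; exact: measurable_funB.
rewrite -ge0_integralD//; last 4 first.
- by move=> x _; rewrite lee_fin sqr_ge0.
- exact: mRI (L2fun_Re f) (L2fun_Re g).
- by move=> x _; rewrite lee_fin sqr_ge0.
- exact: mRI (L2fun_Im f) (L2fun_Im g).
apply: eq_integral => x _; rewrite -EFinD /pointwise_dot; congr EFin.
rewrite [L2fun_val (f - g) x](_ : _ = f x - g x)//.
by case: (f x) (g x) => ? ? [? ?] /=; lra.
Qed.

(** The Riesz-Fischer theorem for the real and the imaginary parts. *)
Lemma L2_complete (w : nat -> L2 mu) :
  (forall e, 0 < e -> exists N, forall n k, (N <= n)%N -> (N <= k)%N ->
     rdot (w k - w n) (w k - w n) <= e) ->
  exists l, forall e, 0 < e -> exists N, forall n, (N <= n)%N ->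
     rdot (l - w n) (l - w n) <= e.
Proof.
move=> wC; pose f k := repr (w k).
have wE k : w k = \pi_(L2 mu) (f k) by rewrite reprK.
have i0 (h k : T -> R) : (0 <= \int[mu]_x ((h x - k x) ^+ 2)%:E)%E.
  by apply: integral_ge0 => x _; rewrite lee_fin sqr_ge0.
have [e e0|a a2 ha] := @riesz_fischer _ _ _ mu
    (fun k x => complex.Re (f k x)) (fun k => L2fun_Re (f k)).
  have [N HN] := wC e e0; exists N => n k Nn Nk.
  have := HN n k Nn Nk; rewrite -lee_fin 2!wE rdot_sqrB_pi; apply: le_trans.
  by rewrite leeDl.
have [e e0|b b2 hb] := @riesz_fischer _ _ _ mu
    (fun k x => complex.Im (f k x)) (fun k => L2fun_Im (f k)).
  have [N HN] := wC e e0; exists N => n k Nn Nk.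
  have := HN n k Nn Nk; rewrite -lee_fin 2!wE rdot_sqrB_pi; apply: le_trans.
  by rewrite leeDr.
have h2 : (fun x => a x +i* b x) \in @sq_integrable _ _ _ mu.
  by apply/andP; split.
exists (\pi_(L2 mu) (MkL2fun h2)) => e e0.
have e20 : 0 < e / 2 by rewrite divr_gt0.
have [N HN] := ha _ e20; have [M HM] := hb _ e20.
exists (maxn N M) => n; rewrite geq_max => /andP[Nn Mn].
rewrite -lee_fin wE rdot_sqrB_pi/= [e]splitr EFinD.
by apply: leeD; [exact: HN|exact: HM].
Qed.

Lemma rdot_cvg (w : nat -> L2 mu) l v :
  (forall e, 0 < e -> exists N, forall n, (N <= n)%N ->
     rdot (l - w n) (l - w n) <= e) ->
  rdot (w n) v @[n --> \oo] --> rdot l v.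
Proof.
move=> wl; apply/cvgrPdist_le => e e0.
have c0 : 0 < rdot v v + 1 by rewrite ltr_wpDl// rdot_ge0.
have [|N HN] := wl (e ^+ 2 / (rdot v v + 1)).
  by rewrite divr_gt0// exprn_gt0.
exists N => // n /= /HN h.
rewrite -rdotBl -ler_sqr ?nnegrE ?(ltW e0)// real_normK ?num_real//.
apply: (le_trans (rdot_cauchy_schwarz _ _)).
have := rdot_ge0 v; have := rdot_ge0 (l - w n).
move: h; rewrite ler_pdivlMr//; nra.
Qed.

Lemma rdot_sqr_cvg (w : nat -> L2 mu) l :
  (forall e, 0 < e -> exists N, forall n, (N <= n)%N ->
     rdot (l - w n) (l - w n) <= e) ->
  rdot (w n) (w n) @[n --> \oo] --> rdot l l.
Proof.
move=> wl.
have wE n : rdot (w n) (w n) =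
    rdot (l - w n) (l - w n) + 2 * rdot (w n) l - rdot l l.
  by rewrite !(rdotDl, rdotDr, rdotNl, rdotNr) (rdotC l (w n)); lra.
suff : rdot (l - w n) (l - w n) + 2 * rdot (w n) l - rdot l l @[n --> \oo] -->
    0 + 2 * rdot l l - rdot l l.
  under eq_fun do rewrite -wE.
  by rewrite (_ : 0 + _ - _ = rdot l l)//; lra.
apply: cvgB; last exact: cvg_cst.
apply: cvgD; last by apply: cvgM; [exact: cvg_cst|exact: rdot_cvg].
apply/cvgrPdist_le => e /wl[N HN]; exists N => // n /= /HN.
by rewrite sub0r normrN ger0_norm// rdot_ge0.
Qed.

End real_inner_product.

(** * Spectral integrals of simple functions *)

Lemma integral_step d (T : measurableType d) (R : realType)
    (nu : {measure set T -> \bar R}) (c : set T -> R) (I : Type) (s : seq I)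
    (a : I -> R) (A : I -> set T) :
  (forall B, measurable B -> nu B = (c B)%:E) -> (forall i, measurable (A i)) ->
  nu.-integrable setT (EFin \o (fun x => \sum_(i <- s) a i * \1_(A i) x)) /\
  (\int[nu]_x (\sum_(i <- s) a i * \1_(A i) x)%:E =
   (\sum_(i <- s) a i * c (A i))%:E)%E.
Proof.
move=> nuE mA.
have iA i : nu.-integrable setT (EFin \o \1_(A i)).
  apply/integrableP; split.
    by apply/measurable_EFinP; exact: measurable_indic.
  under eq_integral do rewrite /= ger0_norm//.
  by rewrite integral_indic// setIT nuE// ltry.
have iaA i : nu.-integrable setT (fun x => (a i)%:E * (\1_(A i) x)%:E)%E.
  exact: (@integrableZl _ _ _ _ _ measurableT (a i) _ (iA i)).
elim: s => [|i s [IH1 IH2]].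
  rewrite (_ : EFin \o _ = cst 0%E); last first.
    by apply/funext => x /=; rewrite big_nil.
  rewrite big_nil; split; first exact: integrable0.
  by under eq_integral do rewrite big_nil; rewrite integral0.
pose h t := EFin \o (fun x => \sum_(j <- t) a j * \1_(A j) x).
have sumE : h (i :: s) = (fun x => (a i)%:E * (\1_(A i) x)%:E)%E \+ h s.
  by apply/funext => x; rewrite /h /= big_cons EFinD.
split; first by rewrite -/(h _) sumE; exact: integrableD.
rewrite -[LHS]/(integral nu setT (h (i :: s))) sumE integralD//= IH2.
rewrite (@integralZl _ _ _ _ _ measurableT _ (iA i))/= integral_indic//.
by rewrite setIT nuE// big_cons EFinD EFinM.
Qed.

Section step_operator.
Context d (T : measurableType d) (R : realType).
Variable mu : {measure set T -> \bar R}.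
Variables (E : spectral_measure mu) (u : L2 mu).
Local Notation X := (measurableTypeR R).
Implicit Types (A B : set X) (v w : L2 mu).

Lemma rdot_projr B v w : measurable B -> rdot v (E B w) = rdot (E B v) w.
Proof. by move=> mB; rewrite /rdot Defs.proj_selfadjoint. Qed.

Lemma rdot_proj_proj A B : measurable A -> measurable B ->
  rdot (E A u) (E B u) = rdot (E (A `&` B) u) u.
Proof. by move=> mA mB; rewrite rdot_projr// Defs.proj_mul// setIC. Qed.

Lemma spectral_diagE B : measurable B ->
  Defs.spectral_diag E u B = (rdot (E B u) u)%:E.
Proof.
move=> mB; rewrite -[LHS]/(crestr0 (spectral_Re E u u) (@measurableT _ X) B).
by rewrite /crestr0 mem_set// /crestr setIT.
Qed.

Import HBNNSimple.
Implicit Types h g : {nnsfun X >-> R}.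

(** The spectral integral of the simple function [h], applied to [u]. *)
Definition step_op h : L2 mu :=
  \sum_(y <- fset_set (range h)) y%:C *: E (h @^-1` [set y]) u.

Lemma nnsfun_sumE h x :
  h x = \sum_(y <- fset_set (range h)) y * \1_(h @^-1` [set y]) x.
Proof. by rewrite {1}(fimfunE h) fsbig_finite. Qed.

Lemma integral_step_op h v (nu : {measure set X -> \bar R}) :
  (forall A, measurable A -> nu A = (rdot (E A u) v)%:E) ->
  (\int[nu]_x (h x)%:E = (rdot (step_op h) v)%:E)%E.
Proof.
move=> nuE.
have [_ e] := @integral_step _ X R nu (fun A => rdot (E A u) v) R
  (fset_set (range h)) id (fun y => h @^-1` [set y]) nuE
  (fun y => measurable_sfunP h (measurable_set1 y)).
under eq_integral do rewrite nnsfun_sumE.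
rewrite e rdot_suml; congr EFin.
by apply: eq_bigr => y _; rewrite rdotZl.
Qed.

(** Because [E(A)] and [E(B)] are commuting orthogonal projections,
    [<E(A) u, E(B) u> = m (A `&` B)], which is the integral of the product of
    the two indicators; the rest is bilinearity. *)
Lemma integral_step_op_mul h g :
  (Defs.spectral_diag E u).-integrable setT (EFin \o (fun x => h x * g x)) /\
  (\int[Defs.spectral_diag E u]_x (h x * g x)%:E =
   (rdot (step_op h) (step_op g))%:E)%E.
Proof.
pose hg := [seq (y, z) | y <- fset_set (range h), z <- fset_set (range g)].
have hgE x : h x * g x = \sum_(p <- hg)
    (p.1 * p.2) * \1_(h @^-1` [set p.1] `&` g @^-1` [set p.2]) x.
  rewrite nnsfun_sumE (nnsfun_sumE g) big_distrlr/= big_allpairs/=.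
  by apply: eq_bigr => y _; apply: eq_bigr => z _; rewrite indicI/=; ring.
have [i e] := @integral_step _ X R (Defs.spectral_diag E u)
  (fun A => rdot (E A u) u) (R * R)%type hg (fun p => p.1 * p.2)
  (fun p => h @^-1` [set p.1] `&` g @^-1` [set p.2]) spectral_diagE
  (fun p => measurableI _ _ (measurable_sfunP h (measurable_set1 p.1))
                            (measurable_sfunP g (measurable_set1 p.2))).
split; first by rewrite (funext hgE).
under eq_integral do rewrite hgE.
rewrite e big_allpairs rdot_suml; congr EFin; apply: eq_bigr => y _.
rewrite rdot_sumr; apply: eq_bigr => z _.
by rewrite rdotZl rdotZr rdot_proj_proj ?mulrA.
Qed.

Lemma step_op_isometry h g :
  ((rdot (step_op h - step_op g) (step_op h - step_op g))%:E =
  \int[Defs.spectral_diag E u]_x ((h x - g x) ^+ 2)%:E)%E.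
Proof.
have [ihh ehh] := integral_step_op_mul h h.
have [ihg ehg] := integral_step_op_mul h g.
have [igg egg] := integral_step_op_mul g g.
have -> : (fun x => ((h x - g x) ^+ 2)%:E) =
   (((EFin \o (fun x => (h x * h x)%R)) \-
     (EFin \o (fun x => (h x * g x)%R))) \+
    ((EFin \o (fun x => (g x * g x)%R)) \-
     (EFin \o (fun x => (h x * g x)%R))))%E.
  by apply/funext => x /=; rewrite -!EFinB -EFinD; congr EFin; ring.
rewrite integralD//; try exact: integrableB.
rewrite !integralB//= ehh ehg egg -!EFinB -EFinD; congr EFin.
by rewrite rdotBl !rdotBr (rdotC (step_op g) (step_op h)); ring.
Qed.

End step_operator.

(** * Spectral integrals of nonnegative functions *)

Lemma integral_cvg_nondecreasing d (T : measurableType d) (R : realType)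
    (nu : {measure set T -> \bar R}) (g : nat -> T -> R) (l : T -> R) :
  (forall k, measurable_fun setT (g k)) -> (forall k x, 0 <= g k x) ->
  (forall x, {homo (fun k => g k x) : i j / (i <= j)%N >-> i <= j}) ->
  (forall x, g k x @[k --> \oo] --> l x) ->
  (\int[nu]_x (g k x)%:E @[k --> \oo] --> \int[nu]_x (l x)%:E)%E.
Proof.
move=> mg g0 ndg gl.
have -> : (\int[nu]_x (l x)%:E = \int[nu]_x limn (fun k => (g k x)%:E))%E.
  apply: eq_integral => x _; apply/esym/cvg_lim => //.
  by apply: cvg_EFin; [exact: nearW|exact: gl].
apply: cvg_monotone_convergence => //.
- by move=> k; apply/measurable_EFinP.
- by move=> k x _; rewrite lee_fin.
- by move=> x _ i j ij; rewrite lee_fin ndg.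
Qed.

Section nonneg_calculus.
Context d (T : measurableType d) (R : realType).
Variable mu : {measure set T -> \bar R}.
Variables (E : spectral_measure mu) (u : L2 mu).
Local Notation X := (measurableTypeR R).
Local Notation m := (Defs.spectral_diag E u).
Import HBNNSimple.

Variable f : X -> R.
Hypotheses (mf : measurable_fun setT f) (f0 : forall x, 0 <= f x).
Hypothesis fdom : (\int[m]_x (f x ^+ 2)%:E < +oo)%E.

Let mEf : measurable_fun setT (EFin \o f).
Proof. exact/measurable_EFinP. Qed.

Let h (k : nat) : {nnsfun X >-> R} := nnsfun_approx measurableT mEf k.

Let h_nd x : {homo (fun k => h k x) : i j / (i <= j)%N >-> i <= j}.
Proof. by move=> i j ij; apply/lefP; exact: nd_nnsfun_approx. Qed.

Let h_cvg x : h k x @[k --> \oo] --> f x.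
Proof.
have f0' y : setT y -> (0 <= (EFin \o f) y)%E by move=> _; rewrite lee_fin.
have := cvg_nnsfun_approx measurableT mEf f0' (I : setT x).
by move/fine_cvgP => [].
Qed.

Let h_le k x : h k x <= f x.
Proof.
have hc : cvgn (fun k => h k x) by apply/cvg_ex; exists (f x).
have /cvg_lim <- // := @h_cvg x.
exact: (nondecreasing_cvgn_le (h_nd x) hc).
Qed.

Let mh k : measurable_fun setT (h k). Proof. exact: measurable_funP. Qed.

Let h0 k x : 0 <= h k x. Proof. exact: fun_ge0. Qed.

Let approx_cvg : (\int[m]_x ((h k x - f x) ^+ 2)%:E @[k --> \oo] --> 0)%E.
Proof.
have fi : m.-integrable setT (fun x => (f x ^+ 2)%:E).
  apply/integrableP; split.
    by apply/measurable_EFinP; exact: measurable_funX.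
  by under eq_integral do rewrite gee0_abs ?lee_fin ?sqr_ge0//.
have [] := @dominated_convergence _ _ _ m setT measurableT
  (fun k x => ((h k x - f x) ^+ 2)%:E) (cst 0%E) (fun x => (f x ^+ 2)%:E)
  _ _ _ fi _.
- move=> k; apply/measurable_EFinP.
  by apply: measurable_funX; exact: measurable_funB.
- exact: measurable_cst.
- apply: aeW => x _; apply: cvg_EFin; first exact: nearW.
  under [X in X @ _ --> _]eq_fun do rewrite /= expr2.
  rewrite -(mulr0 (0 : R)); apply: cvgM; rewrite -(subrr (f x));
    by apply: cvgB => //; exact: cvg_cst.
- apply: aeW => x k _; rewrite gee0_abs lee_fin ?sqr_ge0// -sqrrN opprB.
  by rewrite ler_sqr ?nnegrE ?subr_ge0// lerBlDr lerDl.
by move=> _ _; rewrite integral0.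
Qed.

Let Th k := step_op E u (h k).

Let Th_limit : exists w, forall e, 0 < e -> exists N, forall n, (N <= n)%N ->
  rdot (w - Th n) (w - Th n) <= e.
Proof.
apply: L2_complete => e e0.
have e40 : 0 < e / 4 by rewrite divr_gt0.
have [N _ HN] : \forall k \near \oo,
    (\int[m]_x ((h k x - f x) ^+ 2)%:E <= (e / 4)%:E)%E.
  have /fine_cvgP[fin cv] := approx_cvg.
  have /cvgrPdist_le/(_ _ e40) c := cv.
  near=> k.
  have fk : (\int[m]_x ((h k x - f x) ^+ 2)%:E)%E \is a fin_num by near: k.
  have : `|0 - fine (\int[m]_x ((h k x - f x) ^+ 2)%:E)%E| <= e / 4 by near: k.
  rewrite sub0r normrN ger0_norm; first by rewrite -lee_fin fineK.
  by apply: fine_ge0; apply: integral_ge0 => x _; rewrite lee_fin sqr_ge0.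
exists N => n k Nn Nk; rewrite -lee_fin step_op_isometry.
have mB (a b : X -> R) : measurable_fun setT a -> measurable_fun setT b ->
    measurable_fun setT (fun x => a x - b x).
  by move=> ma mb; exact: measurable_funB.
apply: le_trans (integral_sqr_le m (mB _ _ (mh k) (mh n)) (mB _ _ mf (mh n))) _.
have -> : (e%:E = 2%:E * (e / 4)%:E + 2%:E * (e / 4)%:E)%E.
  by rewrite -EFinM -EFinD; congr EFin; lra.
apply: leeD; apply: lee_wpmul2l => //.
  under eq_integral do rewrite opprB addrA subrK.
  exact: HN.
under eq_integral do rewrite -sqrrN opprB.
exact: HN.
Unshelve. all: by end_near. Qed.

(** Both formulas pass to the limit along the simple functions [h k]: their
    integrals converge by monotone convergence, and the inner products because
    [step_op E u (h k)] converges to [w] in norm. In particular the integral of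
    [f] in the second formula is finite. *)
Lemma nonneg_spectral_vector : exists w,
  (rdot w w)%:E = (\int[m]_x (f x ^+ 2)%:E)%E /\
  forall v (nu : {measure set X -> \bar R}),
    (forall A, measurable A -> nu A = (rdot (E A u) v)%:E) ->
    (\int[nu]_x (f x)%:E = (rdot w v)%:E)%E.
Proof.
have [w wl] := Th_limit; exists w; split.
  have c1 : ((rdot (Th k) (Th k))%:E @[k --> \oo] --> (rdot w w)%:E)%E.
    by apply: cvg_EFin; [exact: nearW|exact: rdot_sqr_cvg].
  apply: (cvg_unique (@ereal_hausdorff R) c1).
  rewrite (_ : (fun k => _) =
      (fun k => \int[m]_x (h k x * h k x)%:E)%E); last first.
    by apply/funext => k; rewrite (integral_step_op_mul E u (h k) (h k)).2.
  rewrite (_ : (\int[m]_x (f x ^+ 2)%:E = \int[m]_x (f x * f x)%:E)%E)//.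
  apply: (@integral_cvg_nondecreasing _ _ _ m (fun k x => h k x * h k x)).
  - by move=> k; exact: measurable_funM.
  - by move=> k x; rewrite mulr_ge0.
  - by move=> x i j ij; rewrite ler_pM// h_nd.
  - by move=> x; apply: cvgM.
move=> v nu nuE.
have c1 : ((rdot (Th k) v)%:E @[k --> \oo] --> (rdot w v)%:E)%E.
  by apply: cvg_EFin; [exact: nearW|exact: rdot_cvg].
apply/esym/(cvg_unique (@ereal_hausdorff R) c1).
rewrite (_ : (fun k => _) = (fun k => \int[nu]_x (h k x)%:E)%E); last first.
  by apply/funext => k; rewrite (integral_step_op _ nuE).
exact: integral_cvg_nondecreasing.
Qed.

End nonneg_calculus.

(** * Spectral integrals of real functions *)

Section spectral_calculus.
Context d (T : measurableType d) (R : realType).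
Variable mu : {measure set T -> \bar R}.
Variables (E : spectral_measure mu) (u : L2 mu).
Local Notation X := (measurableTypeR R).
Local Notation m := (Defs.spectral_diag E u).
Implicit Types (f g : X -> R) (v w : L2 mu).

(** The vector [w] is [(\int f dE) u], tested on positive measures only. The
    integrability of [f] is included so that the relation is linear in [f]. *)
Definition represents f w := forall v (nu : {measure set X -> \bar R}),
  (forall A, measurable A -> nu A = (rdot (E A u) v)%:E) ->
  nu.-integrable setT (EFin \o f) /\ \int[nu]_x f x = rdot w v.

Lemma representsZ (a : R) f w : represents f w ->
  represents (fun x => a * f x) (a%:C *: w).
Proof.
move=> rf v nu nuE; have [fi fE] := rf _ _ nuE; split.
  exact: (@integrableZl _ _ _ _ _ measurableT a _ fi).
by rewrite RintegralZl// fE rdotZl.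
Qed.

Lemma representsB f g w w' : represents f w -> represents g w' ->
  represents (fun x => f x - g x) (w - w').
Proof.
move=> rf rg v nu nuE.
have [fi fE] := rf _ _ nuE; have [gi gE] := rg _ _ nuE; split.
  exact: (@integrableB _ _ _ _ _ measurableT _ _ fi gi).
by rewrite RintegralB// fE gE rdotBl.
Qed.

Lemma represents_nonneg f : measurable_fun setT f -> (forall x, 0 <= f x) ->
  (\int[m]_x (f x ^+ 2)%:E < +oo)%E ->
  exists2 w, represents f w & (rdot w w)%:E = (\int[m]_x (f x ^+ 2)%:E)%E.
Proof.
move=> mf f0 fdom; have [w [ww wE]] := nonneg_spectral_vector mf f0 fdom.
exists w => // v nu nuE; have e := wE v nu nuE; split.
  apply/integrableP; split; first exact/measurable_EFinP.
  under eq_integral do rewrite /= ger0_norm//.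
  by rewrite e ltry.
by rewrite /Rintegral e.
Qed.

(** For a symbol of any sign, the vector is the difference of those of the
    positive and negative parts. The squares of both parts are at most [f ^ 2],
    and the parallelogram inequality then gives the constant 4. *)
Lemma represents_exists f : measurable_fun setT f ->
  (\int[m]_x (f x ^+ 2)%:E < +oo)%E ->
  exists2 w, represents f w &
    ((rdot w w)%:E <= 4%:E * \int[m]_x (f x ^+ 2)%:E)%E.
Proof.
move=> mf fdom.
have mf2 : measurable_fun setT (fun x => (f x ^+ 2)%:E).
  by apply/measurable_EFinP; exact: measurable_funX.
have part (g : X -> R) : measurable_fun setT g ->
    (forall x, g x ^+ 2 <= f x ^+ 2) ->
    (\int[m]_x (g x ^+ 2)%:E <= \int[m]_x (f x ^+ 2)%:E)%E.
  move=> mg gf; apply: ge0_le_integral => //.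
  - by move=> x _; rewrite lee_fin sqr_ge0.
  - by apply/measurable_EFinP; exact: measurable_funX.
  - by move=> x _; rewrite lee_fin.
pose p x := Num.max (f x) 0; pose q x := Num.max (- f x) 0.
have mp : measurable_fun setT p by exact: measurable_maxr.
have mq : measurable_fun setT q.
  by apply: measurable_maxr => //; exact: measurable_funN.
have p0 x : 0 <= p x by rewrite /p le_max lexx orbT.
have q0 x : 0 <= q x by rewrite /q le_max lexx orbT.
have pf x : p x ^+ 2 <= f x ^+ 2.
  by rewrite /p; case: (leP (f x) 0) => // _; rewrite expr0n sqr_ge0.
have qf x : q x ^+ 2 <= f x ^+ 2.
  by rewrite /q; case: (leP (- f x) 0) => _; rewrite ?sqrrN// expr0n sqr_ge0.
have [wp rp ep] := represents_nonneg mp p0 (le_lt_trans (part _ mp pf) fdom).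
have [wq rq eq] := represents_nonneg mq q0 (le_lt_trans (part _ mq qf) fdom).
exists (wp - wq).
  rewrite (_ : f = (fun x => p x - q x)); first exact: representsB.
  apply/funext => x; rewrite /p /q.
  by case: (leP (f x) 0); case: (leP (- f x) 0); lra.
apply: (@le_trans _ _ (2 * rdot wp wp + 2 * rdot wq wq)%:E).
  by rewrite lee_fin rdot_sqrB_le.
rewrite EFinD !EFinM ep eq.
have -> : (4%:E = 2%:E + 2%:E :> \bar R)%E by rewrite -EFinD; congr EFin; lra.
rewrite ge0_muleDl//; apply: leeD; apply: lee_wpmul2l => //; exact: part.
Qed.

Lemma proj_setT v : E setT v = v.
Proof. by rewrite -{1}(proj_full E v) proj_mul// setTI proj_full. Qed.

Lemma rdot_proj_cover P N v w : measurable P -> measurable N ->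
  P `|` N = setT -> P `&` N = set0 ->
  rdot v (E P w) + rdot v (E N w) = rdot v w.
Proof.
move=> mP mN PN PN0; rewrite !rdot_projr//.
have /= := @chargeU _ _ _ (spectral_Re E v w) _ _ mP mN PN0.
by rewrite PN /spectral_Re proj_setT -EFinD => -[].
Qed.

(** Restricting the charge [A |-> Re <E(A) u, v>] to a set [P] replaces [v] by
    [E(P) v], since [E(A `&` P) = E(P) E(A)] and [E(P)] is self-adjoint. The
    Jordan parts of the charge are thus measures against which [w] was tested,
    and the two contributions add up because [E(P) v + E(N) v = v]. *)
Lemma charge_integral_represents (D : set X) f w v
    (nu : {charge set X -> \bar R}) :
  measurable D ->
  (forall A, measurable A -> nu A = (rdot (E A u) v)%:E) ->
  represents (f \_ D) w -> charge_integral nu D f = rdot w v.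
Proof.
move=> mD nuE rw; rewrite /charge_integral.
move: (cid _) => [P hP]; move: (cid _) => [N hPN] /=.
have [[mP posP] [mN negN] PN PN0] := hPN.
have jp A : measurable A -> jordan_pos hPN A = (rdot (E A u) (E P v))%:E.
  move=> mA; rewrite jordan_posE cjordan_posE /crestr0 mem_set// /crestr.
  rewrite nuE; last exact: measurableI.
  by rewrite rdot_projr// proj_mul// setIC.
have jn A : measurable A -> jordan_neg hPN A = (rdot (E A u) (- E N v))%:E.
  move=> mA; rewrite jordan_negE cjordan_negE /crestr0 mem_set// /crestr.
  rewrite nuE; last exact: measurableI.
  by rewrite rdotNr rdot_projr// proj_mul// setIC EFinN.
transitivity (rdot w (E P v) - rdot w (- E N v)).
  congr (_ - _); rewrite Rintegral_mkcond; first exact: (rw _ _ jp).2.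
  exact: (rw _ _ jn).2.
by rewrite rdotNr opprK rdot_proj_cover.
Qed.

(** The real part of [E_{u,v}] is tested by [v] and its imaginary part by
    [i v]. *)
Lemma represents_graph D f w : measurable D -> spectral_dom E D f u ->
  represents (f \_ D) w -> spectral_graph E D f u w.
Proof.
move=> mD fdom rw; split => // v; rewrite /spectral_integral.
rewrite (charge_integral_represents mD (v := v) _ rw)//.
rewrite (charge_integral_represents mD (v := 'i *: v) _ rw)//.
  by rewrite -Im_dotL2 /rdot; case: (dotL2 w v).
by move=> A mA; rewrite -Im_dotL2.
Qed.

Lemma spectral_op_represents D f w : measurable D -> spectral_dom E D f u ->
  represents (f \_ D) w -> spectral_op E D f u = w.
Proof.
move=> mD fdom rw; have gw := represents_graph mD fdom rw.
apply: xget_unique => // w' gw'; apply: rdot_inj => v.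
by rewrite /rdot gw.2 gw'.2.
Qed.

Lemma represents_inj f w w' : represents f w -> represents f w' -> w = w'.
Proof.
rewrite (_ : f = f \_ setT); last by rewrite patch_setT.
move=> rw rw'; apply: rdot_inj => v.
pose nu : {charge set X -> \bar R} := spectral_Re E u v.
rewrite -(charge_integral_represents (nu := nu) measurableT _ rw)//.
by rewrite -(charge_integral_represents (nu := nu) measurableT _ rw').
Qed.

Lemma represents_norm f w : measurable_fun setT f ->
  (\int[m]_x (f x ^+ 2)%:E < +oo)%E -> represents f w ->
  ((rdot w w)%:E <= 4%:E * \int[m]_x (f x ^+ 2)%:E)%E.
Proof.
move=> mf /(represents_exists mf)[w' rw' w'w'].
by move=> /represents_inj -/(_ _ rw') ->.
Qed.

Lemma spectral_domE (D : set X) f : measurable D ->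
  spectral_dom E D f u = (\int[m]_x (((f \_ D) x) ^+ 2)%:E < +oo)%E :> Prop.
Proof.
move=> mD; rewrite /spectral_dom/= integral_mkcond.
congr (is_true (_ < _)%E); apply: eq_integral => x _.
by rewrite /patch; case: ifPn => // _; rewrite expr0n.
Qed.

End spectral_calculus.

(** * Estimates for exponentials *)

Section exponential_bounds.
Variable R : realType.
Implicit Types x h s : R.

(** Taylor's formula at order two, obtained from [1 + y <= exp y] alone: at
    [y = -x] this reads [exp x - 1 <= x * exp x]. *)
Lemma expR_sub1_sub_le x : `|expR x - 1 - x| <= x ^+ 2 * expR `|x|.
Proof.
have e1 := expR_ge1Dx x.
rewrite ger0_norm; last by lra.
have up : expR x - 1 <= x * expR x.
  have := expR_ge1Dx (- x); rewrite expRN => e2.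
  have : (1 - x) * expR x <= (expR x)^-1 * expR x.
    by rewrite ler_wpM2r ?expR_ge0.
  by rewrite mulVf ?gt_eqF ?expR_gt0//; lra.
have [x0|x0] := leP 0 x.
  rewrite ger0_norm// expr2 -mulrA.
  have := ler_wpM2l x0 up; have := up; lra.
have : 1 <= expR `|x| by apply: le_trans (expR_ge1Dx _); rewrite lerDl.
have : 0 <= x ^+ 2 by exact: sqr_ge0.
have : x * (expR x - 1) <= x * x by rewrite ler_wnM2l ?(ltW x0)//; lra.
move: up e1; nra.
Qed.

Lemma sqr_le_expR (d x : R) : 0 < d -> x ^+ 2 <= 4 / d ^+ 2 * expR (d * `|x|).
Proof.
move=> d0.
have e : expR (d * `|x|) = expR (d * `|x| / 2) ^+ 2.
  by rewrite expr2 -expRD; congr expR; lra.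
have h : d * `|x| / 2 <= expR (d * `|x| / 2).
  by apply: le_trans (expR_ge1Dx _); lra.
have y0 : 0 <= d * `|x| / 2 by rewrite !mulr_ge0// ltW.
rewrite mulrAC ler_pdivlMr ?exprn_gt0// e.
have : (d * `|x| / 2) ^+ 2 <= expR (d * `|x| / 2) ^+ 2.
  by rewrite ler_sqr ?nnegrE ?expR_ge0.
by rewrite !exprMn real_normK ?num_real//; lra.
Qed.

Lemma norm_le_expR (d x : R) : 0 < d -> `|x| <= d^-1 * expR (d * `|x|).
Proof.
move=> d0; rewrite mulrC ler_pdivlMr// mulrC.
by apply: le_trans (expR_ge1Dx _); lra.
Qed.

(** An exponential [l ^ (s +- c)] in [l = exp L] is bounded by 1 below [l = 1]
    and by [l ^ s0] above. *)
Lemma expR_interp (s s0 c e L : R) :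
  0 <= c -> c <= e -> e <= s -> s + e <= s0 ->
  expR (s * L + c * `|L|) <= 1 + expR (s0 * L).
Proof.
move=> c0 ce es es0; have [L0|L0] := leP 0 L.
  rewrite ger0_norm//; apply: le_trans (_ : expR (s0 * L) <= _); last by lra.
  by rewrite ler_expR -mulrDl ler_wpM2r//; lra.
rewrite ltr0_norm//; apply: le_trans (_ : 1 <= _); last first.
  by rewrite lerDl expR_ge0.
have : (s - c) * L <= 0 by rewrite mulr_ge0_le0 ?(ltW L0)//; lra.
by rewrite -expR0 ler_expR; lra.
Qed.

Lemma expR_increment_le (s s0 d h L : R) :
  0 < d -> 2 * d <= s -> s + 2 * d <= s0 -> `|h| <= d ->
  `|expR ((s + h) * L) - expR (s * L) - h * (expR (s * L) * L)| <=
  h ^+ 2 * (4 / d ^+ 2) * (1 + expR (s0 * L)).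
Proof.
move=> d0 ds ds0 hd.
have -> : expR ((s + h) * L) - expR (s * L) - h * (expR (s * L) * L) =
    expR (s * L) * (expR (h * L) - 1 - h * L).
  by rewrite mulrDl expRD; ring.
rewrite normrM ger0_norm ?expR_ge0//.
have b1 := expR_sub1_sub_le (h * L).
have b2 := sqr_le_expR L d0.
have b3 : expR `|h * L| <= expR (d * `|L|) by rewrite ler_expR normrM ler_wpM2r.
have b4 := expR_interp L (mulr_ge0 (ler0n _ 2) (ltW d0)) (lexx _) ds ds0.
have e4 : expR (s * L + 2 * d * `|L|) =
    expR (s * L) * (expR (d * `|L|) * expR (d * `|L|)).
  by rewrite -!expRD; congr expR; ring.
(* One factor [exp (d |L|)] pays for [L ^ 2], the other one for the remainder
   in Taylor's formula. *)
apply: (@le_trans _ _ (expR (s * L) *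
    (h ^+ 2 * (4 / d ^+ 2 * expR (d * `|L|)) * expR (d * `|L|)))).
  rewrite ler_wpM2l ?expR_ge0//; apply: (le_trans b1).
  apply: ler_pM; rewrite ?sqr_ge0 ?expR_ge0//.
  by rewrite exprMn ler_wpM2l ?sqr_ge0.
rewrite e4 in b4.
apply: le_trans (ler_wpM2l _ b4).
  by rewrite le_eqVlt; apply/orP; left; apply/eqP; ring.
by rewrite mulr_ge0 ?sqr_ge0// divr_ge0 ?sqr_ge0.
Qed.

Lemma expR_mul_le (s s0 d L : R) :
  0 < d -> d <= s -> s + d <= s0 ->
  `|expR (s * L) * L| <= d^-1 * (1 + expR (s0 * L)).
Proof.
move=> d0 ds ds0; rewrite normrM ger0_norm ?expR_ge0//.
apply: (@le_trans _ _ (expR (s * L) * (d^-1 * expR (d * `|L|)))).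
  by rewrite ler_wpM2l ?expR_ge0// norm_le_expR.
rewrite mulrCA -expRD ler_wpM2l ?invr_ge0 ?(ltW d0)//.
exact: expR_interp (ltW d0) (lexx _) ds ds0.
Qed.

End exponential_bounds.

(** * The symbols of the powers and of the logarithmic power *)

Section restricted_symbols.
Variable R : realType.
Local Notation X := (measurableTypeR R).

(** The symbols are extended by 0 to the whole line, so that symbols given on
    [[0, +oo[] and on []0, +oo[] can be combined linearly. At 0 all of them
    vanish, since the exponents are positive. *)
Definition power_symbol (t : R) : X -> R := (fun l => l `^ t) \_ `[0, +oo[.

Definition log_power_symbol (s : R) : X -> R :=
  (fun l => l `^ s * ln l) \_ `]0, +oo[.

Lemma power_symbol_gt0 t (l : R) : 0 < l -> power_symbol t l = expR (t * ln l).
Proof.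
move=> l0; rewrite /power_symbol patchE mem_set/=; last by rewrite in_itv/= ltW.
by rewrite /powR gt_eqF.
Qed.

Lemma power_symbol_le0 t (l : R) : t != 0 -> l <= 0 -> power_symbol t l = 0.
Proof.
move=> t0 l0; rewrite /power_symbol patchE; case: ifPn => // /set_mem/=.
rewrite in_itv/= andbT => l0'.
have -> : l = 0 by apply/eqP; rewrite eq_le l0.
by rewrite powR0.
Qed.

Lemma power_symbol_ge0 t (l : R) : 0 <= power_symbol t l.
Proof.
by rewrite /power_symbol patchE; case: ifPn => // _; exact: powR_ge0.
Qed.

Lemma log_power_symbol_gt0 s (l : R) : 0 < l ->
  log_power_symbol s l = expR (s * ln l) * ln l.
Proof.
move=> l0; rewrite /log_power_symbol patchE mem_set/=; last first.
  by rewrite in_itv/= l0.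
by rewrite /powR gt_eqF.
Qed.

Lemma log_power_symbol_le0 s (l : R) : l <= 0 -> log_power_symbol s l = 0.
Proof.
move=> l0; rewrite /log_power_symbol patchE; case: ifPn => // /set_mem/=.
by rewrite in_itv/= andbT ltNge l0.
Qed.

Lemma measurable_power_symbol t : measurable_fun setT (power_symbol t).
Proof.
apply: (iffLR (measurable_restrictT (fun l : X => l `^ t : R) _)).
  exact: measurable_itv.
apply: measurable_funTS; exact: (@measurable_powR R).
Qed.

Lemma measurable_log_power_symbol s : measurable_fun setT (log_power_symbol s).
Proof.
apply: (iffLR (measurable_restrictT (fun l : X => l `^ s * ln l : R) _)).
  exact: measurable_itv.
apply: measurable_funTS.
apply: measurable_funM; first exact: (@measurable_powR R).
exact: (@measurable_ln R).
Qed.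

Lemma power_symbol_le (t s0 l : R) : 0 < t -> t <= s0 ->
  `|power_symbol t l| <= 1 * (1 + power_symbol s0 l).
Proof.
move=> t0 ts0; rewrite ger0_norm ?power_symbol_ge0// mul1r.
have [l0|l0] := leP l 0.
  by rewrite power_symbol_le0 ?gt_eqF// addr_ge0 ?power_symbol_ge0.
rewrite !power_symbol_gt0//.
have := @expR_interp R t s0 0 0 (ln l) (lexx _) (lexx _) (ltW t0).
by rewrite mul0r !addr0; apply.
Qed.

Lemma log_power_symbol_le (s s0 d l : R) : 0 < d -> d <= s -> s + d <= s0 ->
  `|log_power_symbol s l| <= d^-1 * (1 + power_symbol s0 l).
Proof.
move=> d0 ds ds0; have [l0|l0] := leP l 0.
  rewrite log_power_symbol_le0// normr0 mulr_ge0 ?addr_ge0//.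
    by rewrite invr_ge0 ltW.
  exact: power_symbol_ge0.
by rewrite log_power_symbol_gt0// power_symbol_gt0//; exact: expR_mul_le.
Qed.

(** The second-order Taylor estimate in the exponent, divided by [t - s]; it is
    uniform in [l] because [1 + power_symbol s0] dominates both the growth at
    infinity and the logarithm at 0. *)
Lemma difference_quotient_le (s s0 d t l : R) :
  0 < d -> 2 * d <= s -> s + 2 * d <= s0 -> `|t - s| <= d -> t != s ->
  `|(t - s)^-1 * (power_symbol t l - power_symbol s l)
    - log_power_symbol s l| <=
  `|t - s| * (4 / d ^+ 2) * (1 + power_symbol s0 l).
Proof.
move=> d0 ds ds0 tsd tNs.
have ts0 : t - s != 0 by rewrite subr_eq0.
have c0 : 0 <= `|t - s| * (4 / d ^+ 2) by rewrite mulr_ge0// divr_ge0// sqr_ge0.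
have [l0|l0] := leP l 0.
  have sN0 : s != 0 by rewrite gt_eqF//; lra.
  have tN0 : t != 0.
    by rewrite gt_eqF//; move: tsd; rewrite ler_norml => /andP[+ _]; lra.
  rewrite log_power_symbol_le0//.
  rewrite (power_symbol_le0 tN0)// (power_symbol_le0 sN0)//.
  by rewrite !subr0 mulr0 normr0 mulr_ge0 ?addr_ge0 ?power_symbol_ge0.
rewrite !power_symbol_gt0// log_power_symbol_gt0//.
have := @expR_increment_le R s s0 d (t - s) (ln l) d0 ds ds0 tsd.
rewrite (addrC s) subrK => h.
rewrite -(ler_pM2l (_ : 0 < `|t - s|)) ?normr_gt0//.
rewrite -normrM mulrBr mulrA divff// mul1r.
apply: (le_trans h); rewrite -real_normK ?num_real//.
by rewrite le_eqVlt; apply/orP; left; apply/eqP; ring.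
Qed.

End restricted_symbols.

(** * Convergence of the difference quotient *)

Section dominated_symbols.
Context d (T : measurableType d) (R : realType) (m : {measure set T -> \bar R}).

Lemma dominated_sqr_integral (f G : T -> R) (c : R) :
  measurable_fun setT f -> measurable_fun setT G ->
  (forall x, `|f x| <= c * G x) ->
  (\int[m]_x (f x ^+ 2)%:E <= (c ^+ 2)%:E * \int[m]_x (G x ^+ 2)%:E)%E.
Proof.
move=> mf mG fG.
have mG2 : measurable_fun setT (fun x => (G x ^+ 2)%:E).
  by apply/measurable_EFinP; exact: measurable_funX.
rewrite -ge0_integralZl//; last 2 first.
- by move=> x _; rewrite lee_fin sqr_ge0.
- by rewrite lee_fin sqr_ge0.
apply: ge0_le_integral => //.
- by move=> x _; rewrite lee_fin sqr_ge0.
- by apply/measurable_EFinP; exact: measurable_funX.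
- exact: emeasurable_funM.
move=> x _; rewrite -EFinM lee_fin -exprMn -[leLHS]real_normK ?num_real//.
rewrite ler_sqr ?nnegrE//.
exact: le_trans (fG x).
Qed.

Lemma sqr_integrable_add1 (f : T -> R) : (m setT < +oo)%E ->
  measurable_fun setT f -> (\int[m]_x (f x ^+ 2)%:E < +oo)%E ->
  (\int[m]_x ((1 + f x) ^+ 2)%:E < +oo)%E.
Proof.
move=> mT mf foo.
have m1 : measurable_fun setT (fun x => 1 + f x) by exact: measurable_funD.
apply: le_lt_trans (integral_sqr_le m m1 mf) _.
under [X in (2%:E * X + _)%E]eq_integral do rewrite addrK expr1n.
rewrite integral_cst// mul1e.
by rewrite lte_add_pinfty// lte_mul_pinfty.
Qed.

End dominated_symbols.

Theorem proposition1p2 (R : realType) (n : nat) (hn : (1 <= n)%N)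
    (E : spectral_measure (lebesgue_n R n)) (hE : spectral_resolution E)
    (s : R) (hs : 0 < s < 1)
    (u : L2 (lebesgue_n R n)) (s0 : R) (hs0 : s < s0) (hu : sobolev2 E s0 u) :
  [/\ \forall t \near s, sobolev2 E t u,
      sobolev2_log E s u &
      normL2 ((t - s)^-1%:C *: (frac_Laplacian E t u - frac_Laplacian E s u)
              - frac_log_Laplacian E s u) @[t --> s^'] --> (0 : R)].
Proof.
have /andP[s_gt0 _] := hs.
(* The exponents [s - 2 d] and [s + 2 d] stay within [0, s0]. *)
pose d : R := Num.min s (s0 - s) / 2.
have d0 : 0 < d by rewrite divr_gt0// lt_min s_gt0 subr_gt0.
have ds : 2 * d <= s by rewrite /d mulrC divfK ?pnatr_eq0// ge_min lexx.
have ds0 : s + 2 * d <= s0.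
  by rewrite -lerBrDl /d mulrC divfK ?pnatr_eq0// ge_min lexx orbT.
pose m := Defs.spectral_diag E u.
pose G (l : measurableTypeR R) : R := 1 + power_symbol s0 l.
have mG : measurable_fun setT G.
  by apply: measurable_funD => //; exact: measurable_power_symbol.
have iG : (\int[m]_x (G x ^+ 2)%:E < +oo)%E.
  apply: sqr_integrable_add1; first by rewrite spectral_diagE// ltry.
    exact: measurable_power_symbol.
  by move: hu; rewrite /sobolev2 spectral_domE.
have dom (f : measurableTypeR R -> R) (c : R) : measurable_fun setT f ->
    (forall x, `|f x| <= c * G x) ->
    (\int[m]_x (f x ^+ 2)%:E < +oo)%E.
  move=> mf fG; apply: le_lt_trans (dominated_sqr_integral m mf mG fG) _.
  by rewrite lte_mul_pinfty// lee_fin sqr_ge0.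
have near_s t : `|t - s| <= d -> 0 < t /\ t <= s0.
  by rewrite ler_norml => /andP[? ?]; split; lra.
have domt t : `|t - s| <= d -> sobolev2 E t u.
  move=> /near_s[t0 ts0]; rewrite /sobolev2 spectral_domE//.
  apply: (dom _ 1); first exact: measurable_power_symbol.
  by move=> l; exact: power_symbol_le.
have doms : sobolev2 E s u by apply: domt; rewrite subrr normr0 ltW.
have doml : sobolev2_log E s u.
  rewrite /sobolev2_log spectral_domE//.
  apply: (dom _ d^-1); first exact: measurable_log_power_symbol.
  by move=> l; apply: log_power_symbol_le => //; lra.
split => //.
  apply/nbhs_ballP; exists d => //= t; rewrite /ball/= distrC => /ltW.
  exact: domt.
have rept t : `|t - s| <= d ->
    represents E u (power_symbol t) (frac_Laplacian E t u).
  move=> td.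
  have [|w rw _] :=
    represents_exists (E := E) (u := u) (measurable_power_symbol t).
    by move: (domt t td); rewrite /sobolev2 spectral_domE.
  by rewrite /frac_Laplacian (spectral_op_represents _ (domt t td) rw).
have repl : represents E u (log_power_symbol s) (frac_log_Laplacian E s u).
  have [|w rw _] :=
    represents_exists (E := E) (u := u) (measurable_log_power_symbol s).
    by move: doml; rewrite /sobolev2_log spectral_domE.
  by rewrite /frac_log_Laplacian (spectral_op_represents _ doml rw).
(* 4 comes from [represents_norm], its square factor from the bound on the
   difference quotient. *)
pose M : R := 4 * (4 / d ^+ 2) ^+ 2 * fine (\int[m]_x (G x ^+ 2)%:E)%E.
have M0 : 0 <= M.
  apply: mulr_ge0; first by rewrite mulr_ge0 ?sqr_ge0.
  apply: fine_ge0; apply: integral_ge0 => x _.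
  by rewrite lee_fin sqr_ge0.
have key t : `|t - s| <= d -> t != s ->
  normL2 ((t - s)^-1%:C *: (frac_Laplacian E t u - frac_Laplacian E s u)
              - frac_log_Laplacian E s u) <= `|t - s| * Num.sqrt M.
  move=> td tNs.
  set w := (X in normL2 X).
  pose F (l : measurableTypeR R) : R :=
    (t - s)^-1 * (power_symbol t l - power_symbol s l) - log_power_symbol s l.
  have mF : measurable_fun setT F.
    apply: measurable_funB; last exact: measurable_log_power_symbol.
    apply: measurable_funM => //.
    by apply: measurable_funB; exact: measurable_power_symbol.
  have FG l : `|F l| <= (`|t - s| * (4 / d ^+ 2)) * G l.
    exact: difference_quotient_le.
  have rF : represents E u F w.
    apply: representsB => //; apply: representsZ.
    apply: representsB; first exact: rept.
    by apply: rept; rewrite subrr normr0 ltW.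
  have wF := represents_norm mF (dom _ _ mF FG) rF.
  have : rdot w w <= `|t - s| ^+ 2 * M.
    rewrite -lee_fin; apply: (le_trans wF).
    apply: le_trans (lee_wpmul2l _ (dominated_sqr_integral m mF mG FG)) _ => //.
    rewrite -[X in (_ * (_ * X) <= _)%E]fineK; last first.
      rewrite ge0_fin_numE//; apply: integral_ge0 => x _.
      by rewrite lee_fin sqr_ge0.
    by rewrite -!EFinM lee_fin /M le_eqVlt; apply/orP; left; apply/eqP; ring.
  move=> wM; rewrite /normL2 -/(rdot w w).
  have -> : `|t - s| * Num.sqrt M = Num.sqrt (`|t - s| ^+ 2 * M).
    by rewrite (sqrtrM M (sqr_ge0 _)) sqrtr_sqr normr_id.
  by rewrite ler_wsqrtr.
apply/cvgrPdist_le => e e0.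
have r0 : 0 < Num.min d (e / (Num.sqrt M + 1)).
  by rewrite lt_min d0 divr_gt0// ltr_wpDl ?sqrtr_ge0.
apply/nbhs_ballP; exists (Num.min d (e / (Num.sqrt M + 1))) => //= t.
rewrite /ball/= distrC lt_min => /andP[/ltW td /ltW te] tNs.
rewrite sub0r normrN ger0_norm ?sqrtr_ge0//.
apply: (le_trans (key t td tNs)).
move: te; rewrite ler_pdivlMr; last by rewrite ltr_wpDl ?sqrtr_ge0.
apply: le_trans; rewrite ler_wpM2l// lerDl//.
Qed.
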